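(* Let $\delta\in E_0$ be nonzero, let $1\le k\le n$, and suppose that $n=2m$ with $m\equiv k\pmod 2$. Let $G_1=\widetilde{G}_{\delta,k}$ be the spin double cover of the group $G_{\delta,k}$ corresponding to the Hermitian form $\psi_{\delta,k}$ on $W=E^{2n}$. Then the $E[G_1]$-module $S^+$ is the extension to $E$ of an $E_0[G_1]$-module (that is, $S^+\cong S_0\otimes_{E_0}E$ for some $E_0[G_1]$-module $S_0$). In particular, if $k=1$ and $n=2m=6$, then the representation $S^+$ of $G_1=\widetilde{G}_{\delta,1}$ is defined over $E_0$.
   Context: $E_0$ is a totally real number field or $\mathbb{R}$, and $E$ is an imaginary (totally imaginary) quadratic extension of $E_0$ ($E=\mathbb{C}$ if $E_0=\mathbb{R}$), with conjugation $\alpha\mapsto\bar\alpha$. Let $e_1,\dots,e_{2n}$ be the standard basis of $W=E^{2n}$ and write $z=\sum z_ie_i$, $w=\sum w_ie_i$. Set $b(z,w)=\sum_{i=1}^n(z_iw_{n+i}+z_{n+i}w_i)$ and, for nonzero $\delta\in E_0$ and $1\le k\le n$, $$\psi_{\delta,k}(z,w)=\delta\sum_{i=1}^kz_i\bar w_i+\sum_{i=k+1}^nz_i\bar w_i-\sum_{i=1}^kz_{n+i}\bar w_{n+i}-\delta\sum_{i=k+1}^nz_{n+i}\bar w_{n+i}.$$ $G_{\delta,k}$ is the algebraic group over $E_0$ of $E$-linear automorphisms of $W$ of determinant $1$ preserving $b$ and $\psi_{\delta,k}$. Its spin double cover $\widetilde{G}_{\delta,k}$ is its preimage in $\mathrm{Res}_{E/E_0}\mathrm{Spin}(W,b)$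 (Weil restriction), an algebraic group over $E_0$. Let $W_1=\operatorname{span}_E\{e_1,\dots,e_n\}$. $S^+=\bigwedge^{\mathrm{even}}W_1$ (over $E$), with $\mathrm{Spin}(W,b)\subseteq C^{\mathrm{even}}(W,b)^*$ acting via the Clifford module structure in which $e_i$ ($i\le n$) acts by wedge product with $e_i$ and $e_{n+i}$ acts by $2$ times the interior product with the dual basis vector $e_i^*\in W_1^\vee$ (Clifford relations $e_ie_{n+i}+e_{n+i}e_i=2$, all other pairs anticommuting and $e_r^2=0$). $\widetilde{G}_{\delta,k}$ acts on $S^+$ by restriction.
   Formalization: The spin double cover is taken to be the identity component of the preimage of G in Res Spin(W,b); the full preimage has kernel Res μ₂ of order 4, is not a double cover, and the claim fails for it. *)

(* Defs.v *)
From HB Require Import structures.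
From mathcomp Require Import all_boot all_order all_algebra all_field.
From mathcomp Require Import reals complex.

Set Implicit Arguments.
Unset Strict Implicit.
Unset Printing Implicit Defensive.

Import Order.TTheory GRing.Theory Num.Theory.
Local Open Scope ring_scope.

(* -------------------------------------------------------------------------- *)
(* Exterior algebra of B^N with basis e_J, J a subset of 'I_N, where e_J is   *)
(* the wedge of the e_j for j in J in increasing order; x J is the            *)
(* coefficient of e_J in x.                                                   *)
(* -------------------------------------------------------------------------- *)

Definition exta (B : comNzRingType) (N : nat) := {ffun {set 'I_N} -> B^o}.
HB.instance Definition _ (B : comNzRingType) (N : nat) :=
  GRing.Lmodule.copy (exta B N) {ffun {set 'I_N} -> B^o}.

Section Exterior.
Variables (B : comNzRingType) (N : nat).
Implicit Types (x y : exta B N) (i j : 'I_N) (I J : {set 'I_N}).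

Definition ebase I : exta B N := [ffun J : {set 'I_N} => (J == I)%:R].

Definition esgn i J : B := (-1) ^+ #|[set j in J | (j < i)%N]|.

Definition wedge i x : exta B N :=
  [ffun J : {set 'I_N} => if i \in J then esgn i J * x (J :\ i) else 0].

Definition contract i x : exta B N :=
  [ffun J : {set 'I_N} => if i \in J then 0 else esgn i J * x (i |: J)].

Fact wedge_is_linear i : linear (wedge i).
Proof.
move=> a x y; apply/ffunP=> J; rewrite !ffunE; case: ifP => _.
  by rewrite mulrDr /GRing.scale /= mulrCA.
by rewrite scaler0 addr0.
Qed.
HB.instance Definition _ i :=
  GRing.isLinear.Build B (exta B N) (exta B N) _ (wedge i) (wedge_is_linear i).

Fact contract_is_linear i : linear (contract i).
Proof.
move=> a x y; apply/ffunP=> J; rewrite !ffunE; case: ifP => _.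
  by rewrite scaler0 addr0.
by rewrite mulrDr /GRing.scale /= mulrCA.
Qed.
HB.instance Definition _ i :=
  GRing.isLinear.Build B (exta B N) (exta B N) _ (contract i)
    (contract_is_linear i).

Lemma esgnD1 i j J : j \in J ->
  esgn i J = (-1) ^+ (j < i)%N * esgn i (J :\ j).
Proof.
move=> jJ; rewrite /esgn -exprD; congr (_ ^+ _).
rewrite (cardsD1 j) inE jJ /=; congr (_ + _)%N.
by apply: eq_card => k; rewrite !inE; case: (k == j).
Qed.

Lemma esgnU1 i j J : j \notin J ->
  esgn i (j |: J) = (-1) ^+ (j < i)%N * esgn i J.
Proof. by move=> jJ; rewrite (@esgnD1 i j) ?setU11 // setU1K. Qed.

Lemma wedge_anti i j x : i != j -> wedge i (wedge j x) = - wedge j (wedge i x).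
Proof.
move=> ij; apply/ffunP=> J; rewrite !ffunE !in_setD1 [j == i]eq_sym ij /=.
have [iJ|_] := ifPn; have [jJ|_] := ifPn; rewrite ?mulr0 ?oppr0 //.
rewrite (esgnD1 i jJ) (esgnD1 j iJ) setDDl setUC -setDDl.
case: (ltngtP j i) ij => [ji|ji|/val_inj->]; last by rewrite eqxx.
  by move=> _; rewrite /= expr0 expr1 ?mul1r ?mulN1r ?mulNr ?mulrN ?mulNr ?opprK !mulrA [esgn i _ * _]mulrC ?addNr ?subrr.
by move=> _; rewrite /= expr0 expr1 ?mul1r ?mulN1r ?mulNr ?mulrN ?mulNr ?opprK !mulrA [esgn i _ * _]mulrC ?addNr ?subrr.
Qed.

Lemma wedge_sq i x : wedge i (wedge i x) = 0.
Proof. by apply/ffunP=> J; rewrite !ffunE setD11 mulr0; case: ifP. Qed.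

Lemma contract_anti i j x :
  i != j -> contract i (contract j x) = - contract j (contract i x).
Proof.
move=> ij; apply/ffunP=> J; rewrite !ffunE !in_setU1 [j == i]eq_sym (negbTE ij) /=.
have [_|iJ] := ifPn; have [_|jJ] := ifPn; rewrite ?mulr0 ?oppr0 //.
rewrite (esgnU1 i jJ) (esgnU1 j iJ) setUCA.
case: (ltngtP j i) ij => [ji|ji|/val_inj->]; last by rewrite eqxx.
  by move=> _; rewrite /= expr0 expr1 ?mul1r ?mulN1r ?mulNr ?mulrN ?mulNr ?opprK !mulrA [esgn i _ * _]mulrC ?addNr ?subrr.
by move=> _; rewrite /= expr0 expr1 ?mul1r ?mulN1r ?mulNr ?mulrN ?mulNr ?opprK !mulrA [esgn i _ * _]mulrC ?addNr ?subrr.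
Qed.

Lemma contract_sq i x : contract i (contract i x) = 0.
Proof. by apply/ffunP=> J; rewrite !ffunE setU11 mulr0; case: ifP. Qed.

Lemma esgn_sq i J : esgn i J * esgn i J = 1.
Proof. by rewrite /esgn -expr2 sqrr_sign. Qed.

Lemma contract_wedge i j x :
  contract i (wedge j x) + wedge j (contract i x) = (i == j)%:R *: x.
Proof.
apply/ffunP=> J; rewrite !ffunE !in_setU1 !in_setD1.
have [->|ij] := eqVneq i j.
  rewrite scale1r ?eqxx /=; have [jJ|jJ] := ifPn.
    by rewrite setD1K // add0r (esgnD1 j jJ) // ltnn mul1r mulrA esgn_sq mul1r.
  by rewrite setU1K // addr0 (esgnU1 j jJ) // ltnn mul1r mulrA esgn_sq mul1r.
rewrite ?scale0r ?[j == i]eq_sym ?(negbTE ij) /=.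
have [iJ|iJ] := ifPn; have [jJ|jJ] := ifPn; rewrite ?mulr0 ?addr0 //.
have -> : (i |: J) :\ j = i |: (J :\ j).
  by apply/setP => k; rewrite !inE; case: eqVneq => // ->; rewrite [j == i]eq_sym (negbTE ij).
rewrite (esgnU1 j iJ) (esgnD1 i jJ).
case: (ltngtP j i) ij => [ji|ji|/val_inj->]; last by rewrite eqxx.
  by move=> _; rewrite /= expr0 expr1 ?mul1r ?mulN1r ?mulNr ?mulrN ?mulNr ?opprK !mulrA [esgn i _ * _]mulrC ?addNr ?subrr.
by move=> _; rewrite /= expr0 expr1 ?mul1r ?mulN1r ?mulNr ?mulrN ?mulNr ?opprK !mulrA [esgn i _ * _]mulrC ?addNr ?subrr.
Qed.

End Exterior.

(* -------------------------------------------------------------------------- *)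
(* Clifford algebra of the quadratic module B^N with Gram matrix b, with the  *)
(* convention v * v = b(v, v), hence v * w + w * v = 2 b(v, w).               *)
(* It is realised on the module of the exterior algebra: e_I stands for the   *)
(* Clifford product of the e_i, i in I, in increasing order (cl_basisE), and  *)
(* left multiplication by e_i is Chevalley's operator e_i ^ _ + beta(e_i) _|  *)
(* for the triangular bilinear form beta with beta(v, v) = b(v, v).           *)
(* cl_universal is the universal property of the Clifford algebra.            *)
(* -------------------------------------------------------------------------- *)

Section CliffordGenerators.
Variables (B : comNzRingType) (N : nat) (b : 'M[B]_N).
Implicit Types (x y : exta B N) (i j : 'I_N) (I J : {set 'I_N}).

Definition cbeta i j : B :=
  if i == j then b i i else if (j < i)%N then b i j *+ 2 else 0.

Definition cgen i x : exta B N := wedge i x + \sum_j cbeta i j *: contract j x.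

Fact cgen_is_linear i : linear (cgen i).
Proof.
move=> a x y; rewrite /cgen linearP scalerDr -!addrA; congr (_ + _).
rewrite addrCA; congr (_ + _); rewrite scaler_sumr -big_split /=.
by apply: eq_bigr => j _; rewrite linearP scalerDr !scalerA mulrC.
Qed.
HB.instance Definition _ i :=
  GRing.isLinear.Build B (exta B N) (exta B N) _ (cgen i) (cgen_is_linear i).

Let C (a : 'I_N -> B) x := \sum_j a j *: contract j x.

Lemma contract_sum_comm (a a' : 'I_N -> B) x : C a (C a' x) = - C a' (C a x).
Proof.
pose F (u v : 'I_N -> B) k l : exta B N :=
  (u k * v l) *: contract k (contract l x).
have CE u v : C u (C v x) = \sum_k \sum_l F u v k l.
  apply: eq_bigr => k _; rewrite linear_sum scaler_sumr.
  by apply: eq_bigr => l _; rewrite linearZ /= scalerA.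
rewrite !CE exchange_big -sumrN; apply: eq_bigr => l _ /=.
rewrite -sumrN; apply: eq_bigr => k _.
rewrite /F mulrC -scalerN; congr (_ *: _).
by have [->|kl] := eqVneq k l; [rewrite contract_sq oppr0|rewrite contract_anti].
Qed.

Lemma contract_sum_sq (a : 'I_N -> B) x : C a (C a x) = 0.
Proof.
pose F k l : exta B N := (a k * a l) *: contract k (contract l x).
have -> : C a (C a x) = \sum_k \sum_l F k l.
  apply: eq_bigr => k _; rewrite linear_sum scaler_sumr.
  by apply: eq_bigr => l _; rewrite linearZ /= scalerA.
have FA k l : F k l = - F l k.
  rewrite /F mulrC -scalerN; congr (_ *: _).
  by have [->|kl] := eqVneq k l; [rewrite contract_sq oppr0|rewrite contract_anti].
under eq_bigr => k _ do rewrite (bigID (fun l : 'I_N => (l < k)%N)) /=.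
rewrite big_split /= [X in _ + X](exchange_big_dep xpredT) //= -big_split /=.
apply: big1 => l _; rewrite [X in _ + X](bigD1 l) /= ?ltnn //.
rewrite {2}/F contract_sq scaler0 add0r.
rewrite [X in _ + X](eq_bigl (fun k : 'I_N => (k < l)%N)).
  by rewrite -big_split /= big1 // => k _; rewrite FA addNr.
by move=> k; rewrite -leqNgt ltn_neqAle andbC.
Qed.

Lemma wedge_contract_sum i (a : 'I_N -> B) x :
  C a (wedge i x) + wedge i (C a x) = a i *: x.
Proof.
rewrite /C linear_sum -big_split /= (bigD1 i) //= big1 => [|j ji].
  by rewrite linearZ -scalerDr contract_wedge eqxx scale1r addr0.
by rewrite linearZ -scalerDr contract_wedge (negbTE ji) scale0r scaler0.
Qed.

Let CD a x y : C a (x + y) = C a x + C a y.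
Proof. by rewrite /C -big_split; apply: eq_bigr => j _ /=; rewrite linearD scalerDr. Qed.

Let cgenC i x : cgen i x = wedge i x + C (cbeta i) x. Proof. by []. Qed.

Lemma cgen_sq i x : cgen i (cgen i x) = b i i *: x.
Proof.
rewrite !cgenC linearD CD /= wedge_sq add0r contract_sum_sq addr0 addrC.
by rewrite wedge_contract_sum /cbeta eqxx.
Qed.

Lemma cgen_anti i j x : (j < i)%N ->
  cgen i (cgen j x) + cgen j (cgen i x) = (b i j *+ 2) *: x.
Proof.
move=> ji; have ij : i != j by rewrite neq_ltn ji orbT.
rewrite !cgenC !linearD !CD /= wedge_anti // contract_sum_comm.
have -> : (b i j *+ 2) *: x = cbeta i j *: x + cbeta j i *: x.
  by rewrite /cbeta (negbTE ij) eq_sym (negbTE ij) ji ltnNge ltnW //= scale0r addr0.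
rewrite -(wedge_contract_sum j (cbeta i)) -(wedge_contract_sum i (cbeta j)).
by rewrite (AC ((2*2)*(2*2)) ((1*5)*(4*8)*((3*6)*(7*2)))) /= !addNr !add0r.
Qed.

End CliffordGenerators.

Section Action.
Variables (B : comNzRingType) (N : nat) (V : lmodType B) (d : 'I_N -> V -> V).
Implicit Types (x y : exta B N) (v : V) (i j : 'I_N) (I J : {set 'I_N}).

(* Action of x = \sum_I x_I e_I when e_i acts by d i; enum I is increasing.   *)
Definition cact x v : V := \sum_I x I *: foldr d v (enum I).

Fact cact_linearl v : linear (cact^~ v).
Proof.
move=> a x y; rewrite /cact scaler_sumr -big_split /=; apply: eq_bigr => I _.
by rewrite !ffunE scalerDl scalerA.
Qed.

Lemma cact_ebase I v : cact (ebase B I) v = foldr d v (enum I).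
Proof.
rewrite /cact (bigD1 I) //= big1 => [|J JI]; last by rewrite ffunE (negbTE JI) scale0r.
by rewrite ffunE eqxx scale1r addr0.
Qed.

End Action.

Section SortedBasis.
Variables (B : comNzRingType) (N : nat) (b : 'M[B]_N).
Implicit Types (x y z : exta B N) (i j : 'I_N) (I J : {set 'I_N}).
Implicit Types (s : seq 'I_N).

Let ord_lt := relpre (@nat_of_ord N) ltn.

Let ord_lt_trans : transitive ord_lt.
Proof. by move=> ? ? ?; apply: ltn_trans. Qed.

Let enum_sorted I : sorted ord_lt (enum I).
Proof.
rewrite {1}/enum_mem; apply: sorted_filter => //.
by rewrite -enumT /ord_lt -sorted_map val_enum_ord iota_ltn_sorted.
Qed.

Let enum_setE s : sorted ord_lt s -> enum [set j in s] = s.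
Proof.
move=> ss; apply: (irr_sorted_eq ord_lt_trans) => //.
  by move=> i; rewrite /ord_lt /= ltnn.
by move=> i; rewrite mem_enum inE.
Qed.

Let above j z := forall I, z I != 0 -> {in I, forall i, (j < i)%N}.

Lemma exta_sum z : z = \sum_I z I *: ebase B I.
Proof.
apply/ffunP=> J; rewrite sum_ffunE (bigD1 J) //= big1 => [|I IJ].
  by rewrite !ffunE eqxx addr0 /GRing.scale /= mulr1.
by rewrite !ffunE eq_sym (negbTE IJ) /GRing.scale /= mulr0.
Qed.

Lemma cgen_ebase j J : {in J, forall i, (j < i)%N} ->
  cgen b j (ebase B J) = ebase B (j |: J).
Proof.
move=> jJ; have nJ : j \notin J by apply/negP => /jJ; rewrite ltnn.
rewrite /cgen big1 ?addr0 => [|i _].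
  apply/ffunP=> K; rewrite !ffunE; have [jK|jK] := ifPn; last first.
    by case: eqP jK => // ->; rewrite setU11.
  have [->|KJ] := eqVneq K (j |: J).
    rewrite setU1K // eqxx mulr1 /esgn (_ : [set _ in _ | _] = set0) ?cards0 //.
    apply/setP=> i; rewrite !inE; apply/negbTE; rewrite negb_and -leqNgt.
    by have [->|_] /= := eqVneq i j; rewrite ?leqnn ?orbT //; case: (boolP (i \in J)) => //= /jJ /ltnW.
  by case: eqP => [KE|_]; rewrite ?mulr0 //; case/eqP: KJ; rewrite -KE setD1K.
rewrite /cbeta; case: ifP => [/eqP<-|_]; last case: ifP => [ij|_]; rewrite ?scale0r //.
  rewrite (_ : contract _ _ = 0) ?scaler0 //; apply/ffunP=> K; rewrite !ffunE.
  by case: ifP => // _; case: eqP => [E|_]; rewrite ?mulr0 //; case/negP: nJ; rewrite -E setU11.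
rewrite (_ : contract _ _ = 0) ?scaler0 //; apply/ffunP=> K; rewrite !ffunE.
case: ifP => // _; case: eqP => [E|_]; rewrite ?mulr0 //.
have iJ : i \in J by rewrite -E setU11.
by have := ltn_trans (jJ _ iJ) ij; rewrite ltnn.
Qed.

Lemma cgen_sorted s : sorted ord_lt s ->
  foldr (cgen b) (ebase B set0) s = ebase B [set j in s].
Proof.
elim: s => [_|j s IHs /= js]; first by congr ebase; apply/setP=> i; rewrite !inE.
rewrite IHs ?(path_sorted js) // cgen_ebase => [|i]; last first.
  by rewrite inE; move/(order_path_min ord_lt_trans)/allP: js; apply.
by congr ebase; apply/setP=> i; rewrite !inE.
Qed.

Lemma cgen_enum I : foldr (cgen b) (ebase B set0) (enum I) = ebase B I.
Proof.
by rewrite cgen_sorted //; congr ebase; apply/setP=> i; rewrite !inE mem_enum.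
Qed.

Variables (V : lmodType B) (d : 'I_N -> V -> V).
Hypothesis d_linear : forall i, linear (d i).
Hypothesis d_sq : forall i v, d i (d i v) = b i i *: v.
Hypothesis d_anti : forall i j v, (j < i)%N ->
  d i (d j v) + d j (d i v) = (b i j *+ 2) *: v.

Let L i : {linear V -> V} := HB.pack (d i) (GRing.isLinear.Build B V V _ (d i) (d_linear i)).

Let cact_lin v : {linear exta B N -> V} :=
  HB.pack ((cact d)^~ v) (GRing.isLinear.Build B (exta B N) V _ _ (cact_linearl d v)).

Let cact_above j z v : above j z -> cact d (cgen b j z) v = d j (cact d z v).
Proof.
move=> jz; rewrite [z in cgen b j z]exta_sum linear_sum.
rewrite -[LHS]/(cact_lin v _) linear_sum /= -[RHS]/(L j _) linear_sum /=.
apply: eq_bigr => I _; rewrite linearZ -[LHS]/(cact_lin v _) linearZ -[RHS]/(L j _) linearZ /=.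
have [->|/jz jI] := eqVneq (z I) 0; first by rewrite !scale0r.
congr (_ *: _); rewrite cgen_ebase // cact_ebase.
suff -> : enum (j |: I) = j :: enum I by [].
have -> : j |: I = [set i in j :: enum I].
  by apply/setP=> i; rewrite !inE mem_enum.
apply: enum_setE; rewrite /= (path_sortedE ord_lt_trans) enum_sorted andbT.
by apply/allP=> i; rewrite mem_enum => /jI.
Qed.

Let cgen_above i j z : (j < i)%N -> above j z -> above j (cgen b i z).
Proof.
move=> ji jz I; rewrite /cgen !ffunE sum_ffunE.
case: (boolP [forall k in I, (j < k)%N]) => [/forall_inP // | /forall_inPn[k kI jk]].
have z0 (K : {set 'I_N}) : k \in K -> z K = 0.
  by move=> kK; apply/eqP; apply: contraNT jk => /jz; apply.
rewrite big1 ?addr0 => [|l _].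
  case: ifP => [iI|]; last by rewrite eqxx.
  rewrite z0 ?mulr0 ?eqxx // !inE kI andbT.
  by apply: contraNneq jk => ->.
by rewrite !ffunE; case: ifP => _; rewrite ?scaler0 // z0 ?mulr0 ?scaler0 // !inE kI orbT.
Qed.

Let cact_sorted i s v : sorted ord_lt s ->
  cact d (cgen b i (ebase B [set j in s])) v = d i (foldr d v s).
Proof.
elim: s i => [|j s IHs] i ss.
  rewrite cgen_ebase => [|k]; last by rewrite inE.
  by rewrite cact_ebase (_ : _ |: _ = [set k in [:: i]]) ?enum_setE //;
     apply/setP=> k; rewrite !inE orbF.
have js k : k \in s -> (j < k)%N.
  by move/(order_path_min ord_lt_trans)/allP: ss; apply.
have s' := path_sorted ss.
have aj : above j (ebase B [set k in s]).
  move=> I; rewrite ffunE; have [-> _ k|_] := eqVneq I; last by rewrite eqxx.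
  by rewrite inE; apply: js.
have sE : ebase B [set k in j :: s] = cgen b j (ebase B [set k in s]).
  rewrite cgen_ebase => [|k]; last by rewrite inE; apply: js.
  by congr ebase; apply/setP=> k; rewrite !inE.
case: (ltngtP i j) => [ij|ji|/val_inj ->].
- rewrite cact_above ?cact_ebase ?enum_setE // => I; rewrite ffunE.
  have [-> _ k|_] := eqVneq I; last by rewrite eqxx.
  by rewrite !inE => /orP[/eqP->//|/js]; apply: ltn_trans.
- rewrite sE (canRL (addrK _) (cgen_anti b _ ji)).
  rewrite -[LHS]/(cact_lin v _) linearB linearZ /= cact_ebase enum_setE // ?d_sq.
  rewrite cact_above; last exact: cgen_above.
  by rewrite IHs // -d_anti // addrK.
- rewrite sE cgen_sq -[LHS]/(cact_lin v _) linearZ /= cact_ebase enum_setE // ?d_sq.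
Qed.

Lemma cact_cgen i y v : cact d (cgen b i y) v = d i (cact d y v).
Proof.
rewrite [y in cgen b i y]exta_sum linear_sum -[LHS]/(cact_lin v _) linear_sum.
rewrite -[RHS]/(L i _) linear_sum /=; apply: eq_bigr => I _.
rewrite linearZ -[LHS]/(cact_lin v _) linearZ -[RHS]/(L i _) linearZ /=.
congr (_ *: _); rewrite -(cact_sorted i v (enum_sorted I)); congr (cact _ (cgen _ _ (ebase _ _)) _).
by apply/setP=> j; rewrite inE mem_enum.
Qed.

Fact cact_linearr x : linear (cact d x).
Proof.
move=> a u v; rewrite /cact scaler_sumr -big_split /=; apply: eq_bigr => I _.
rewrite scalerA mulrC -scalerA -scalerDr; congr (_ *: _).
by elim: (enum I) => //= i s ->; rewrite d_linear.
Qed.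

Lemma cact_comp x y v : cact d (cact (cgen b) x y) v = cact d x (cact d y v).
Proof.
rewrite {1 3}/cact -[LHS]/(cact_lin v _) linear_sum /=; apply: eq_bigr => I _.
rewrite -[LHS]/(cact_lin v _) linearZ /=; congr (_ *: _).
by elim: (enum I) => //= i s IHs; rewrite cact_cgen IHs.
Qed.

End SortedBasis.

Definition cliff (B : comNzRingType) (N : nat) (b : 'M[B]_N) := exta B N.
HB.instance Definition _ (B : comNzRingType) (N : nat) (b : 'M[B]_N) :=
  GRing.Lmodule.copy (cliff b) (exta B N).

Section Clifford.
Variables (B : comNzRingType) (N : nat) (b : 'M[B]_N).
Implicit Types (x y z : cliff b) (i j : 'I_N) (I : {set 'I_N}).

Definition cl_one : cliff b := ebase B set0.
Definition cl_mul x y : cliff b := cact (cgen b) x y.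

Fact cl_mulA : associative cl_mul.
Proof.
move=> x y z; rewrite /cl_mul cact_comp //.
- exact: cgen_is_linear.
- exact: cgen_sq.
- exact: cgen_anti.
Qed.

Fact cl_mul1 : left_id cl_one cl_mul.
Proof. by move=> x; rewrite /cl_mul cact_ebase enum_set0. Qed.

Fact cl_mulr1 : right_id cl_one cl_mul.
Proof.
move=> x; rewrite /cl_mul /cact [RHS]exta_sum; apply: eq_bigr => I _.
by rewrite cgen_enum.
Qed.

Fact cl_mulDl : left_distributive cl_mul +%R.
Proof. by move=> x y z; have := cact_linearl (cgen b) z 1 x y; rewrite !scale1r. Qed.

Fact cl_mulDr : right_distributive cl_mul +%R.
Proof.
by move=> x y z; have := cact_linearr (cgen_is_linear b) x 1 y z; rewrite !scale1r.
Qed.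

Fact cl_one_neq0 : cl_one != 0.
Proof.
by apply/eqP => /ffunP/(_ set0)/eqP; rewrite !ffunE eqxx oner_eq0.
Qed.

HB.instance Definition _ := GRing.Zmodule_isNzRing.Build (cliff b)
  cl_mulA cl_mul1 cl_mulr1 cl_mulDl cl_mulDr cl_one_neq0.

Fact cl_scaleAl (a : B) x y : a *: (x * y) = a *: x * y.
Proof.
rewrite -[RHS]/(cact (cgen b) (a *: (x : exta B N)) y).
rewrite -[LHS]/(a *: cact (cgen b) x y) /cact scaler_sumr.
by apply: eq_bigr => I _; rewrite ffunE scalerA.
Qed.

HB.instance Definition _ := GRing.Lmodule_isLalgebra.Build B (cliff b) cl_scaleAl.

Fact cl_scaleAr (a : B) x y : a *: (x * y) = x * (a *: y).
Proof.
have lin := cact_linearr (cgen_is_linear b) x.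
have l0 : cact (cgen b) x 0 = 0.
  by have := lin (-1) 0 0; rewrite scaler0 addr0 scaleN1r addNr.
by have := lin a y 0; rewrite l0 !addr0.
Qed.

HB.instance Definition _ := GRing.Lalgebra_isAlgebra.Build B (cliff b) cl_scaleAr.

Definition cl_gen i : cliff b := ebase B [set i].

Definition cl_vec (v : 'cV[B]_N) : cliff b := \sum_i v i 0 *: cl_gen i.

Lemma cl_genM i x : cl_gen i * x = cgen b i x.
Proof. by rewrite /cl_gen -[LHS]/(cact _ _ _) cact_ebase enum_set1. Qed.

Lemma cl_basisE I : ebase B I = \prod_(i <- enum I) cl_gen i :> cliff b.
Proof.
rewrite -(cgen_enum b); elim: (enum I) => [|i s IHs]; first by rewrite big_nil.
by rewrite big_cons /= IHs cl_genM.
Qed.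

Lemma cl_gen_sq i : cl_gen i * cl_gen i = (b i i)%:A.
Proof. by rewrite -{2}[cl_gen i]mulr1 !cl_genM cgen_sq. Qed.

Lemma cl_gen_anti i j : (j < i)%N ->
  cl_gen i * cl_gen j + cl_gen j * cl_gen i = (b i j *+ 2)%:A.
Proof.
move=> ji; rewrite -{1}[cl_gen j]mulr1 -{2}[cl_gen i]mulr1 !cl_genM.
exact: cgen_anti.
Qed.

Lemma cl_vec_sq (v : 'cV[B]_N) : b^T = b ->
  cl_vec v * cl_vec v = ((v^T *m b *m v) 0 0)%:A.
Proof.
move=> bT; rewrite /cl_vec mulr_suml.
under eq_bigr => i _ do rewrite mulr_sumr.
pose F i j := (v i 0 * v j 0) *: (cl_gen i * cl_gen j).
pose G i j : cliff b := (v i 0 * v j 0 * b i j)%:A.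
have bC i j : b i j = b j i by rewrite -{1}bT mxE.
have -> : \sum_i \sum_j v i 0 *: cl_gen i * (v j 0 *: cl_gen j) = \sum_i \sum_j F i j.
  apply: eq_bigr => i _; apply: eq_bigr => j _.
  by rewrite -scalerAl -scalerAr scalerA.
have -> : ((v^T *m b *m v) 0 0)%:A = \sum_i \sum_j G i j.
  rewrite mxE scaler_suml exchange_big /=; apply: eq_bigr => i _.
  rewrite mxE mulr_suml scaler_suml; apply: eq_bigr => j _.
  by rewrite /G mxE mulrAC.
have S (H : 'I_N -> 'I_N -> cliff b) : \sum_i \sum_j H i j =
  \sum_i H i i + \sum_(i < N) \sum_(j < N | (j < i)%N) (H i j + H j i).
  have E (i : 'I_N) : \sum_j H i j =
      H i i + (\sum_(j < N | (j < i)%N) H i j + \sum_(j < N | (i < j)%N) H i j).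
    rewrite (bigD1 i) //= (bigID (fun j : 'I_N => (j < i)%N)) /=.
    congr (_ + (_ + _)); apply: eq_bigl => j.
      by rewrite andbC; case: ltngtP => // ji; rewrite neq_ltn ji.
    by rewrite -leqNgt [RHS]ltn_neqAle eq_sym.
  rewrite (eq_bigr _ (fun i _ => E i)) !big_split /=; congr (_ + _).
  under [RHS]eq_bigr => i _ do rewrite big_split /=.
  rewrite big_split /=; congr (_ + _).
  by rewrite (exchange_big_dep xpredT).
rewrite !S; congr (_ + _).
  by apply: eq_bigr => i _; rewrite /F /G cl_gen_sq scalerA.
apply: eq_bigr => i _; apply: eq_bigr => j ji.
rewrite /F /G [v j 0 * v i 0]mulrC -scalerDr cl_gen_anti // -scalerDl.
by rewrite [b j i]bC -mulrDr scalerA mulr2n.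
Qed.


Lemma cl_universal (D : algType B) (d : 'I_N -> D) :
  (forall i, d i * d i = (b i i)%:A) ->
  (forall i j, (j < i)%N -> d i * d j + d j * d i = (b i j *+ 2)%:A) ->
  exists f : {lrmorphism cliff b -> D},
    (forall i, f (cl_gen i) = d i) /\
    (forall g : {lrmorphism cliff b -> D},
       (forall i, g (cl_gen i) = d i) -> g =1 f).
Proof.
move=> dsq danti.
have dlin i : linear (fun v : D => d i * v) by move=> a u v; rewrite mulrDr scalerAr.
have dS i (v : D) : d i * (d i * v) = b i i *: v.
  by rewrite mulrA dsq -scalerAl mul1r.
have dA i j (v : D) : (j < i)%N ->
    d i * (d j * v) + d j * (d i * v) = (b i j *+ 2) *: v.
  by move=> ji; rewrite !mulrA -mulrDl danti // -scalerAl mul1r.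
pose f x := cact (fun i v => d i * v) x 1.
have fE x v : cact (fun i v => d i * v) x v = f x * v.
  rewrite /f /cact mulr_suml; apply: eq_bigr => I _; rewrite -scalerAl.
  by congr (_ *: _); elim: (enum I) => [|i s IHs] /=; rewrite ?mul1r // IHs mulrA.
have fM : monoid_morphism (f : cliff b -> D).
  split; first by rewrite /f cact_ebase enum_set0.
  by move=> x y; rewrite /f -[x * y]/(cact (cgen b) x y) cact_comp // fE.
pose F : {lrmorphism cliff b -> D} := HB.pack (f : cliff b -> D)
  (GRing.isLinear.Build B (cliff b) D _ (f : cliff b -> D) (cact_linearl _ 1))
  (GRing.isMonoidMorphism.Build (cliff b) D (f : cliff b -> D) fM).
exists F; split=> [i|g gE x].
  by rewrite /= /f cact_ebase enum_set1 /= mulr1.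
rewrite [x](exta_sum x) !linear_sum; apply: eq_bigr => I _.
rewrite !linearZ /=; congr (_ *: _); rewrite /f cact_ebase cl_basisE rmorph_prod.
elim: (enum I) => [|i s IHs]; first by rewrite big_nil.
by rewrite big_cons /= IHs gE.
Qed.


(* The anti-automorphism fixing the vectors: it reverses products of vectors. *)
Definition cl_rev x : cliff b := \sum_I x I *: \prod_(i <- rev (enum I)) cl_gen i.

(* The even part C^even is spanned by the e_I with #|I| even.                 *)
Definition cl_even x := forall I, odd #|I| -> x I = 0.

End Clifford.

(* -------------------------------------------------------------------------- *)
(* Spin group and half-spin module of W = B^(2n) with its hyperbolic form b;  *)
(* the basis vectors e_1 .. e_n, e_(n+1) .. e_(2n) have the indices           *)
(* lshift n i and rshift n i, i : 'I_n.                                       *)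
(* -------------------------------------------------------------------------- *)

Section Spin.
Variables (B : comNzRingType) (n : nat).
Implicit Types (z w v : 'cV[B]_(n + n)) (i j : 'I_n).

Definition bW z w : B :=
  \sum_(i < n) (z (lshift n i) 0 * w (rshift n i) 0 +
                z (rshift n i) 0 * w (lshift n i) 0).

Definition gramW : 'M[B]_(n + n) :=
  \matrix_(i, j) bW (delta_mx i 0) (delta_mx j 0).

Lemma bW_delta (p q : 'I_(n + n)) : bW (delta_mx p 0) (delta_mx q 0) =
  match split p, split q with
  | inl i, inr j | inr i, inl j => (i == j)%:R
  | _, _ => 0
  end.
Proof.
have E (i j : 'I_n) : (lshift n i == rshift n j) = false.
  by rewrite -val_eqE /=; apply/negbTE; rewrite neq_ltn ltn_addr.
rewrite /bW; case: split_ordP => i ->; case: split_ordP => j ->.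
- by rewrite big1 // => l _; rewrite !mxE ![rshift n l == lshift _ _]eq_sym !E /= mulr0 mul0r addr0.
- rewrite (bigD1 i) //= big1 => [|l li].
    rewrite !mxE !eqxx ![rshift n _ == lshift _ _]eq_sym !E /= mul1r mul0r addr0 addr0.
    by rewrite (inj_eq (@rshift_inj _ _)) andbT.
  by rewrite !mxE (inj_eq (@lshift_inj _ _)) (negbTE li) ![rshift n _ == lshift _ _]eq_sym !E /= !mul0r addr0.
- rewrite (bigD1 i) //= big1 => [|l li].
    rewrite !mxE !eqxx !E /= mul0r mul1r add0r addr0.
    by rewrite (inj_eq (@lshift_inj _ _)) andbT.
  by rewrite !mxE (inj_eq (@rshift_inj _ _)) (negbTE li) !E /= !mul0r addr0.
- by rewrite big1 // => l _; rewrite !mxE !E /= mulr0 mul0r addr0.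
Qed.

Definition in_spin (x : cliff gramW) : Prop :=
  [/\ cl_even x, x * cl_rev x = 1, cl_rev x * x = 1 &
      forall v, exists w, x * cl_vec gramW v * cl_rev x = cl_vec gramW w].

Definition spinor_gen (p : 'I_(n + n)) (s : exta B n) : exta B n :=
  match split p with
  | inl i => wedge i s
  | inr i => 2 *: contract i s
  end.

Definition spinor_act (x : cliff gramW) (s : exta B n) : exta B n :=
  cact spinor_gen x s.

Fact spinor_gen_linear p : linear (spinor_gen p).
Proof.
move=> a s t; rewrite /spinor_gen; case: split => i; rewrite linearP //.
by rewrite scalerDr !scalerA mulrC.
Qed.

Fact spinor_gen_sq p s : spinor_gen p (spinor_gen p s) = gramW p p *: s.
Proof.
rewrite mxE bW_delta /spinor_gen; case: split => i.
  by rewrite wedge_sq scale0r.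
by rewrite linearZ /= contract_sq !scaler0 scale0r.
Qed.

Fact spinor_gen_anti (p q : 'I_(n + n)) s : (q < p)%N ->
  spinor_gen p (spinor_gen q s) + spinor_gen q (spinor_gen p s) =
  (gramW p q *+ 2) *: s.
Proof.
rewrite mxE bW_delta /spinor_gen.
case: split_ordP => i ->; case: split_ordP => j -> /= ji.
- by rewrite wedge_anti ?addNr ?mul0rn ?scale0r // -val_eqE neq_ltn ji orbT.
- by case/negP: (ltn_geF ji); rewrite ltnW // ltn_addr.
- by rewrite linearZ -scalerDr contract_wedge scalerA mulr_natl.
- rewrite !linearZ /= contract_anti; last by rewrite -val_eqE neq_ltn; rewrite ltn_add2l in ji; rewrite ji orbT.
  by rewrite !scalerN addNr mul0rn scale0r.
Qed.

Lemma spinor_act1 s : spinor_act 1 s = s.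
Proof. by rewrite /spinor_act cact_ebase enum_set0. Qed.

Lemma spinor_actM x y s :
  spinor_act (x * y) s = spinor_act x (spinor_act y s).
Proof.
rewrite /spinor_act -[x * y]/(cact (cgen gramW) x y) cact_comp //.
- exact: spinor_gen_linear.
- exact: spinor_gen_sq.
- exact: spinor_gen_anti.
Qed.

Lemma spinor_act_gen p s : spinor_act (cl_gen gramW p) s = spinor_gen p s.
Proof. by rewrite /spinor_act cact_ebase enum_set1. Qed.

Definition half_spin (s : exta B n) : Prop :=
  forall I : {set 'I_n}, odd #|I| -> s I = 0.

(* i : 'I_n is the index i + 1 of the basis, so (i < k) reads i + 1 <= k.      *)
Definition psiW (bar : B -> B) (d : B) (k : nat) z w : B :=
  d * (\sum_(i < n | (i < k)%N) z (lshift n i) 0 * bar (w (lshift n i) 0)) +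
  \sum_(i < n | (k <= i)%N) z (lshift n i) 0 * bar (w (lshift n i) 0) -
  \sum_(i < n | (i < k)%N) z (rshift n i) 0 * bar (w (rshift n i) 0) -
  d * (\sum_(i < n | (k <= i)%N) z (rshift n i) 0 * bar (w (rshift n i) 0)).

Definition in_G (bar : B -> B) (d : B) (k : nat) (g : 'M[B]_(n + n)) : Prop :=
  [/\ \det g = 1, forall z w, bW (g *m z) (g *m w) = bW z w &
      forall z w, psiW bar d k (g *m z) (g *m w) = psiW bar d k z w].

Definition spin_preimage (bar : B -> B) (d : B) (k : nat) (x : cliff gramW) :=
  in_spin x /\
  exists2 g, in_G bar d k g &
             forall v, x * cl_vec gramW v * cl_rev x = cl_vec gramW (g *m v).

End Spin.

(* -------------------------------------------------------------------------- *)
(* E (x)_F A for a finite field extension E of F, as the free A-module on the *)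
(* basis vbasis {:E} of E.                                                    *)
(* -------------------------------------------------------------------------- *)

Definition tens (F : fieldType) (E : fieldExtType F) (A : comAlgType F) :=
  'rV[A]_(\dim {:E}).
HB.instance Definition _ (F : fieldType) (E : fieldExtType F)
  (A : comAlgType F) := GRing.Zmodule.copy (tens E A) 'rV[A]_(\dim {:E}).

Section Tensor.
Variables (F : fieldType) (E : fieldExtType F) (A : comAlgType F).
Implicit Types (x y z : tens E A) (e f : E) (a c : A).

Local Notation bas := (vbasis {:E}).
Local Notation co := (coord bas).

Definition tpure e a : tens E A := \row_l (co l e *: a).

Definition tmul x y : tens E A :=
  \row_l \sum_(i < \dim {:E}) \sum_(j < \dim {:E})
    co l (bas`_i * bas`_j) *: (x 0 i * y 0 j).

Let basE e : e = \sum_(i < \dim {:E}) co i e *: bas`_i.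
Proof. by apply: coord_vbasis; apply: memvf. Qed.

Lemma tpureDl e f a : tpure (e + f) a = tpure e a + tpure f a.
Proof. by apply/rowP=> l; rewrite !mxE linearD scalerDl. Qed.

Lemma tpureDr e a c : tpure e (a + c) = tpure e a + tpure e c.
Proof. by apply/rowP=> l; rewrite !mxE scalerDr. Qed.

Lemma tpureZ (t : F) e a : tpure (t *: e) a = tpure e (t *: a).
Proof. by apply/rowP=> l; rewrite !mxE linearZ /= mulrC scalerA. Qed.

Lemma tpure_sum x : x = \sum_(i < \dim {:E}) tpure bas`_i (x 0 i).
Proof.
apply/rowP=> l; rewrite summxE (bigD1 l) //= big1 => [|i il]; rewrite mxE coord_free ?(basis_free (vbasisP _)) //.
  by rewrite eqxx scale1r addr0.
by case: eqP il => [->|_ _]; rewrite ?eqxx ?scale0r.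
Qed.

Lemma tpureM e f a c : tmul (tpure e a) (tpure f c) = tpure (e * f) (a * c).
Proof.
apply/rowP=> l; rewrite !mxE {2}[e]basE {2}[f]basE mulr_suml linear_sum scaler_suml.
apply: eq_bigr => i _; rewrite mulr_sumr linear_sum scaler_suml.
apply: eq_bigr => j _; rewrite !mxE -scalerAl -!scalerAr !linearZ /= -!scalerA.
rewrite -scalerAl [in LHS]scalerA [in LHS]mulrC -[in LHS]scalerA.
have -> (t : F) (g : E) : co l (t *: g) = t * co l g by rewrite linearZ.
by rewrite -[in RHS]scalerA.
Qed.

Fact tmulDl : left_distributive tmul +%R.
Proof.
move=> x y z; apply/rowP=> l; rewrite !mxE -big_split; apply: eq_bigr => i _ /=.
rewrite -big_split; apply: eq_bigr => j _ /=.
by rewrite !mxE mulrDl scalerDr.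
Qed.

Fact tmulC : commutative tmul.
Proof.
move=> x y; apply/rowP=> l; rewrite !mxE exchange_big; apply: eq_bigr => i _.
by apply: eq_bigr => j _; rewrite mulrC [x 0 _ * _]mulrC.
Qed.

Let tmulDr : right_distributive tmul +%R.
Proof. by move=> x y z; rewrite tmulC tmulDl !(tmulC x). Qed.

Let tmul_sumr x (I : finType) (G : I -> tens E A) :
  tmul x (\sum_i G i) = \sum_i tmul x (G i).
Proof.
apply: (big_morph _ (tmulDr x)).
by apply: (addIr (tmul x 0)); rewrite -tmulDr !add0r.
Qed.

Let tmul_suml x (I : finType) (G : I -> tens E A) :
  tmul (\sum_i G i) x = \sum_i tmul (G i) x.
Proof. by rewrite tmulC tmul_sumr; apply: eq_bigr => i _; rewrite tmulC. Qed.

Fact tmulA : associative tmul.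
Proof.
move=> x y z; rewrite [x]tpure_sum [y]tpure_sum [z]tpure_sum.
rewrite !tmul_suml; apply: eq_bigr => i _.
rewrite !(tmul_sumr (tpure bas`_i (x 0 i))) tmul_suml; apply: eq_bigr => j _.
rewrite !tmul_sumr; apply: eq_bigr => l _.
by rewrite !tpureM !mulrA.
Qed.

Fact tmul1 : left_id (tpure 1 1) tmul.
Proof.
move=> x; rewrite [x]tpure_sum tmul_sumr; apply: eq_bigr => i _.
by rewrite tpureM !mul1r.
Qed.

Fact tone_neq0 : tpure 1 1 != 0.
Proof.
apply/eqP => /rowP T0; have /eqP[] := oner_neq0 E.
rewrite [1]basE big1 // => l _; have := T0 l; rewrite !mxE.
have [->|nz E0] := eqVneq (co l (1 : E)) 0; first by rewrite !scale0r.
have /eqP[] := oner_neq0 A.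
by rewrite -[LHS](scalerK nz) E0 scaler0.
Qed.

End Tensor.

HB.instance Definition _ (F : fieldType) (E : fieldExtType F)
  (A : comAlgType F) := GRing.Zmodule_isComNzRing.Build (tens E A)
    (@tmulA F E A) (@tmulC F E A) (@tmul1 F E A) (@tmulDl F E A)
    (@tone_neq0 F E A).

Lemma tens_mulE (F : fieldType) (E : fieldExtType F) (A : comAlgType F)
  (e f : E) (a c : A) : tpure e a * tpure f c = tpure (e * f) (a * c).
Proof. exact: tpureM. Qed.

Section TensorMaps.
Variables (F : fieldType) (E : fieldExtType F).

Definition tens_inl (A : comAlgType F) (e : E) : tens E A := tpure e (1 : A).

Definition tens_inr (A : comAlgType F) (a : A) : tens E A := tpure (1 : E) a.

Definition tens_map (A A' : comAlgType F) (phi : {lrmorphism A -> A'})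
  (x : tens E A) : tens E A' := map_mx phi x.

(* c (x) id_A, for an F-linear map c : E -> E.                                *)
Definition tens_mapl (A : comAlgType F) (c : E -> E) (x : tens E A) :
  tens E A := \sum_(i < \dim {:E}) tpure (c (vbasis {:E})`_i) (x 0 i).

End TensorMaps.

(* -------------------------------------------------------------------------- *)
(* Affine group schemes over F are given by their functors of points on       *)
(* commutative F-algebras, here as subfunctors G of a functor T in monoids    *)
(* (the multiplicative monoids of rings T A, with transition maps Tmap).      *)
(* -------------------------------------------------------------------------- *)

Section GroupFunctors.
Variables (F : fieldType) (T : comAlgType F -> nzRingType).
Variable Tmap : forall A A' : comAlgType F, {lrmorphism A -> A'} -> T A -> T A'.
Variable G : forall A : comAlgType F, T A -> Prop.

(* Idempotents of the coordinate ring of G: natural maps f from G to the      *)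
(* affine line with f * f = f. They cut out the open and closed subschemes    *)
(* of G. Only the values of f on G matter.                                    *)
Definition idempotent_function (f : forall A : comAlgType F, T A -> A) : Prop :=
  (forall A x, G x -> f A x * f A x = f A x) /\
  (forall (A A' : comAlgType F) (phi : {lrmorphism A -> A'}) x,
     G x -> f A' (Tmap phi x) = phi (f A x)).

(* The connected component of 1: an A-point of G lies in it iff no open and   *)
(* closed subscheme of G separates it from 1.                                 *)
Definition identity_component (A : comAlgType F) (x : T A) : Prop :=
  G x /\ forall f, idempotent_function f -> f A x = f A 1.

(* A linear representation of G on F^N, i.e. a morphism of group schemes from *)
(* G to GL_N. Only the values of r on G matter.                               *)
Definition representation (N : nat)
    (r : forall A : comAlgType F, T A -> 'M[A]_N) : Prop :=
  [/\ forall A, r A 1 = 1%:M,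
      forall A x y, G x -> G y -> r A (x * y) = r A x *m r A y &
      forall (A A' : comAlgType F) (phi : {lrmorphism A -> A'}) x,
        G x -> r A' (Tmap phi x) = map_mx phi (r A x)].

End GroupFunctors.

Section HermitianSpin.
Variables (F : fieldType) (E : fieldExtType F) (conj : E -> E).
Variables (n : nat) (delta : F) (k : nat).

Definition WClifford (A : comAlgType F) : nzRingType :=
  cliff (gramW (tens E A) n).

Definition WClifford_map (A A' : comAlgType F) (phi : {lrmorphism A -> A'})
  (x : WClifford A) : WClifford A' :=
  [ffun I : {set 'I_(n + n)} => tens_map phi ((x : exta (tens E A) _) I)].

(* The preimage of G_(delta,k) in Res_(E/F) Spin(W, b).                       *)
Definition G_preimage (A : comAlgType F) (x : WClifford A) : Prop :=
  spin_preimage (tens_mapl (A := A) conj) (tens_inl A delta%:A) k x.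

(* The kernel of the map from G_preimage to G_(delta,k) is Res_(E/F) mu_2,    *)
(* of order 4, and G_preimage has two geometric components; the double cover  *)
(* of G_(delta,k) inside G_preimage is its identity component.                *)
Definition G_spin : forall A : comAlgType F, WClifford A -> Prop :=
  identity_component WClifford_map G_preimage.

Definition exta_inl (A : comAlgType F) (s : exta E n) : exta (tens E A) n :=
  [ffun I : {set 'I_n} => tens_inl A (s I)].

(* s is the image, under an E-linear isomorphism E^N -> S^+, of the standard  *)
(* basis of S_0 = F^N, on which G_spin acts by r; the last condition is the   *)
(* equivariance of this isomorphism, on A-points for all A.                   *)
Definition half_spin_defined_over_base : Prop :=
  exists (N : nat) (r : forall A : comAlgType F, WClifford A -> 'M[A]_N)
         (s : 'I_N -> exta E n),
    [/\ representation WClifford_map G_spin r,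
        forall j, half_spin (s j),
        forall t, half_spin t ->
          exists! c : 'cV[E]_N, t = \sum_j c j 0 *: s j &
        forall A (x : WClifford A), G_spin x -> forall j,
          spinor_act x (exta_inl A (s j)) =
          \sum_i tens_inr E (r A x i j) *: exta_inl A (s i)].

End HermitianSpin.

Definition number_field (F : fieldType) : Prop :=
  exists (K : fieldExtType rat) (f : {rmorphism K -> F}), bijective f.

(* An embedding of a number field into the complex numbers lands in algC.     *)
Definition totally_real (F : fieldType) : Prop :=
  forall (f : {rmorphism F -> algC}) (a : F), f a \is Num.real.

Definition totally_imaginary (F : fieldType) : Prop :=
  forall f : {rmorphism F -> algC}, exists a : F, f a \isn't Num.real.

Definition imaginary_quadratic_ext (F : fieldType) (E : fieldExtType F) : Prop :=
  \dim {:E} = 2%N /\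
  ([/\ number_field F, totally_real F & totally_imaginary E] \/
   exists (R : realType) (f : {rmorphism F -> R}) (g : {rmorphism E -> R[i]}),
     [/\ bijective f, bijective g & forall a : F, g a%:A = (f a)%:C%C]).

(* Main.v *)
Require Import Defs.
From HB Require Import structures.
From mathcomp Require Import all_boot all_order all_algebra all_field.
From mathcomp Require Import reals ring.
Import GRing.Theory.
Local Open Scope ring_scope.

(* Let J be the conjugate-linear map of W with psi(z, w) = b(z, J w); it is a
   similitude of ratio -d with J^2 = -d, and an isometry g of b preserves psi
   iff it commutes with J. On spinors J induces a conjugate-linear map, again
   written J, with J(v s) = (J v)(J s) up to a scalar on odd spinors; it maps
   e_I to a multiple of the wedge on the complement of I. When n = 2m and
   m = k mod 2, its square on S^+ is a square of the base field, so that J can be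
   normalised to J^2 = 1. For x in the preimage of G, x^-1 J x satisfies the same
   intertwining relation as J, whence x^-1 J x = z J for a scalar z. From J^2 = 1
   one gets z conj(z) = 1, and since the invariant bilinear form of the spinors is
   preserved by J and by x, also z^2 = 1. So z is real and (1 + z) / 2 is an
   idempotent function, equal to 1 at 1, hence equal to 1 on the identity
   component. There x commutes with J, and the fixed points of J form S_0. *)

Set Implicit Arguments.
Unset Strict Implicit.

(** * The spin representation and its invariant form *)

Section Spinors.
Variables (B : comNzRingType) (n : nat).
Implicit Types (s t : exta B n) (i : 'I_n) (p : 'I_(n + n)) (I : {set 'I_n}).
Implicit Types (x y : cliff (gramW B n)) (a b : B).

Fact spinor_act_is_linear x : linear (spinor_act x).
Proof. exact: (cact_linearr (@spinor_gen_linear B n) x). Qed.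
HB.instance Definition _ x :=
  GRing.isLinear.Build B (exta B n) (exta B n) _ (spinor_act x)
    (spinor_act_is_linear x).
HB.instance Definition _ p :=
  GRing.isLinear.Build B (exta B n) (exta B n) _ (@spinor_gen B n p)
    (@spinor_gen_linear B n p).

(** The arguments are swapped so that linearity in the Clifford element can be registered as a
    structure. *)
Definition clifford_act_on s x : exta B n := spinor_act x s.

Fact clifford_act_on_linear s : linear (clifford_act_on s).
Proof. exact: cact_linearl. Qed.
HB.instance Definition _ s :=
  GRing.isLinear.Build B (cliff (gramW B n)) (exta B n) _ (clifford_act_on s)
    (clifford_act_on_linear s).

Definition vector_act (v : 'cV[B]_(n + n)) s : exta B n :=
  \sum_p v p 0 *: spinor_gen p s.

Lemma spinor_act_vec v s : spinor_act (cl_vec (gramW B n) v) s = vector_act v s.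
Proof.
rewrite -[LHS]/(clifford_act_on s _) linear_sum; apply: eq_bigr => p _.
by rewrite linearZ /= /clifford_act_on spinor_act_gen.
Qed.

Lemma vector_act_delta p s : vector_act (delta_mx p 0) s = spinor_gen p s.
Proof.
rewrite /vector_act (bigD1 p) //= big1 => [|q qp]; rewrite mxE ?eqxx ?scale1r ?addr0 //.
by rewrite (negbTE qp) scale0r.
Qed.

Lemma spinor_act_prod (l : seq 'I_(n + n)) s :
  spinor_act (\prod_(p <- l) cl_gen (gramW B n) p) s = foldr (@spinor_gen B n) s l.
Proof.
elim: l => [|p l IHl]; first by rewrite big_nil spinor_act1.
by rewrite big_cons spinor_actM IHl spinor_act_gen.
Qed.

(** One operator serves two purposes: with scalars 1 and 0 it is the projection onto S^+, with 1 and
    -1/d it is the correction that J needs on odd spinors. *)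
Definition parity_scale a b s : exta B n :=
  [ffun I : {set 'I_n} => (if odd #|I| then b else a) * s I].

Fact parity_scale_is_linear a b : linear (parity_scale a b).
Proof.
move=> u s t; apply/ffunP => I; rewrite !ffunE mulrDr; congr (_ + _).
by rewrite /GRing.scale /= mulrCA.
Qed.
HB.instance Definition _ a b :=
  GRing.isLinear.Build B (exta B n) (exta B n) _ (parity_scale a b)
    (parity_scale_is_linear a b).

Lemma parity_scale_comp a b a' b' s :
  parity_scale a b (parity_scale a' b' s) = parity_scale (a * a') (b * b') s.
Proof. by apply/ffunP => I; rewrite !ffunE mulrA; case: ifP. Qed.

Lemma parity_scale_ebase a b I :
  parity_scale a b (ebase B I) = (if odd #|I| then b else a) *: ebase B I.
Proof.
apply/ffunP => J; rewrite !ffunE /GRing.scale /=.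
by have [->|_] := eqVneq J I; rewrite ?mulr0.
Qed.

Lemma spinor_gen_parity_scale p a b s :
  spinor_gen p (parity_scale a b s) = parity_scale b a (spinor_gen p s).
Proof.
rewrite /spinor_gen; case: split => i.
  apply/ffunP => I; rewrite !ffunE; case: ifP => iI; last by rewrite mulr0.
  by rewrite (cardsD1 i I) iI /= mulrCA; case: odd.
apply/ffunP => I; rewrite !ffunE.
case: ifPn => iI; rewrite ?scaler0 ?mulr0 //.
by rewrite cardsU1 iI /= /GRing.scale /=; case: odd; rewrite /=; ring.
Qed.

Lemma spinor_act_parity_scale x a b s : cl_even x ->
  spinor_act x (parity_scale a b s) = parity_scale a b (spinor_act x s).
Proof.
move=> xe; rewrite /spinor_act /cact linear_sum; apply: eq_bigr => I _ /=.
rewrite linearZ /=; have [/xe->|] := boolP (odd #|I|); first by rewrite !scale0r.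
(* Each generator exchanges even and odd spinors, hence swaps the two scalars; a word swaps them
   according to the parity of its length. *)
suff -> l : foldr (@spinor_gen B n) (parity_scale a b s) l =
    parity_scale (if odd (size l) then b else a) (if odd (size l) then a else b)
      (foldr (@spinor_gen B n) s l).
  by rewrite -cardE => /negbTE->.
by elim: l => //= p l ->; rewrite spinor_gen_parity_scale; case: odd.
Qed.

Lemma half_spinP s : half_spin s <-> parity_scale 1 0 s = s.
Proof.
split=> [h|<- I]; last by rewrite ffunE => ->; rewrite mul0r.
by apply/ffunP => I; rewrite ffunE; case: ifP => [/h->|_]; rewrite ?mulr0 ?mul1r.
Qed.

Lemma half_spin_act x s : cl_even x -> half_spin s -> half_spin (spinor_act x s).
Proof.
by move=> xe /half_spinP h; apply/half_spinP; rewrite -spinor_act_parity_scale // h.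
Qed.

Lemma half_spin_ebase I : ~~ odd #|I| -> half_spin (ebase B I).
Proof. by move=> eI J; rewrite ffunE; case: eqP => // ->; rewrite (negbTE eI). Qed.

(* This sign makes every generator self-adjoint for [spinor_form]. *)
Definition index_sign I : B := (-1) ^+ (\sum_(i in I) i).

Lemma index_signU1 i I : i \notin I -> index_sign (i |: I) = (-1) ^+ i * index_sign I.
Proof. by move=> iI; rewrite /index_sign big_setU1 //= exprD. Qed.

(** The elements below [i] in [I] and in its complement number [i] together. *)
Lemma esgn_setC i I : esgn B i (~: I) = (-1) ^+ i * esgn B i I.
Proof.
rewrite -[LHS]mulr1 -[X in _ * X](esgn_sq B i I) mulrA; congr (_ * _); rewrite /esgn -exprD.
have -> : [set j in ~: I | (j < i)%N] = [set j : 'I_n | (j < i)%N] :\: I.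
  by apply/setP => j; rewrite !inE.
have -> : [set j in I | (j < i)%N] = [set j : 'I_n | (j < i)%N] :&: I.
  by apply/setP => j; rewrite !inE andbC.
rewrite addnC cardsID cardsE; congr (_ ^+ _).
by rewrite -[RHS](card_ord i) -!sum1_card (big_ord_narrow (ltnW (ltn_ord i))).
Qed.

(** Chevalley's form: the coefficient of the top wedge in the product of [t] with the reversal of
    [s] on its left. *)
Definition spinor_form s t : B := \sum_I index_sign I * s I * t (~: I).

Lemma spinor_formZl a s t : spinor_form (a *: s) t = a * spinor_form s t.
Proof.
rewrite /spinor_form mulr_sumr; apply: eq_bigr => I _; rewrite ffunE /GRing.scale /=.
by ring.
Qed.

Lemma spinor_formZr a s t : spinor_form s (a *: t) = a * spinor_form s t.
Proof.
rewrite /spinor_form mulr_sumr; apply: eq_bigr => I _; rewrite ffunE /GRing.scale /=.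
by ring.
Qed.

Lemma spinor_form_suml (T : finType) (f : T -> exta B n) t :
  spinor_form (\sum_u f u) t = \sum_u spinor_form (f u) t.
Proof.
rewrite /spinor_form exchange_big; apply: eq_bigr => I _ /=.
by rewrite sum_ffunE mulr_sumr mulr_suml.
Qed.

Lemma spinor_form_sumr (T : finType) (f : T -> exta B n) s :
  spinor_form s (\sum_u f u) = \sum_u spinor_form s (f u).
Proof.
rewrite /spinor_form exchange_big; apply: eq_bigr => I _ /=.
by rewrite sum_ffunE mulr_sumr.
Qed.

Lemma spinor_form_ebase I t : spinor_form (ebase B I) t = index_sign I * t (~: I).
Proof.
rewrite /spinor_form (bigD1 I) //= big1 => [|J JI]; rewrite !ffunE ?eqxx ?mulr1 ?addr0 //.
by rewrite (negbTE JI) mulr0 mul0r.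
Qed.

Lemma setCU1 i I : ~: (i |: I) = ~: I :\ i.
Proof. by apply/setP => j; rewrite !inE negb_or andbC. Qed.

Lemma sum_setU1 i (F : {set 'I_n} -> B) :
  \sum_(I : {set 'I_n} | i \in I) F I = \sum_(I : {set 'I_n} | i \notin I) F (i |: I).
Proof.
rewrite (reindex_onto (fun I => i |: I) (fun I => I :\ i)) /=; last first.
  by move=> I iI; rewrite setD1K.
apply: eq_bigl => I; rewrite setU11 /=; apply/eqP/idP => [<-|iI]; last by rewrite setU1K.
by rewrite setD11.
Qed.

(** Moving [i] from [I] to the complement matches the terms of both sides; the sign (-1)^i gained by
    [index_sign] is the one that [esgn] gains under complement. *)
Lemma spinor_form_wedge i s t :
  spinor_form (wedge i s) t = spinor_form s (wedge i t).
Proof.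
transitivity (\sum_(I : {set 'I_n} | i \in I) index_sign I * (esgn B i I * s (I :\ i)) * t (~: I)).
  rewrite [RHS]big_mkcond; apply: eq_bigr => I _; rewrite ffunE.
  by case: ifP; rewrite ?mulr0 ?mul0r.
rewrite sum_setU1 big_mkcond; apply: eq_bigr => I _; rewrite ffunE inE.
case: ifP => iI; rewrite ?mulr0 // setU1K // index_signU1 // (esgnU1 B i iI) ltnn setCU1.
by rewrite esgn_setC /=; ring.
Qed.

Lemma spinor_form_contract i s t :
  spinor_form (contract i s) t = spinor_form s (contract i t).
Proof.
transitivity (\sum_(I : {set 'I_n} | i \in I) index_sign I * s I * (esgn B i (~: I) * t (i |: ~: I))).
  rewrite sum_setU1 [RHS]big_mkcond; apply: eq_bigr => I _; rewrite ffunE.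
  case: ifP => iI; rewrite ?mulr0 ?mul0r //=.
  rewrite index_signU1 ?iI // esgn_setC (esgnU1 B i (negbT iI)) ltnn setCU1 setD1K ?inE ?iI //.
  suff h : (-1) ^+ i * (-1) ^+ i = 1 :> B by rewrite -[LHS]mul1r -[X in X * _ = _]h /=; ring.
  by rewrite -expr2 sqrr_sign.
rewrite big_mkcond; apply: eq_bigr => I _; rewrite ffunE inE.
by case: ifP => iI; rewrite /= ?mulr0.
Qed.

Lemma spinor_form_gen p s t :
  spinor_form (spinor_gen p s) t = spinor_form s (spinor_gen p t).
Proof.
rewrite /spinor_gen; case: split => i; first exact: spinor_form_wedge.
by rewrite spinor_formZl spinor_formZr spinor_form_contract.
Qed.

(** Generators are self-adjoint, so the adjoint of a word of generators is the reversed word. *)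
Lemma spinor_form_rev x s t :
  spinor_form (spinor_act x s) t = spinor_form s (spinor_act (cl_rev x) t).
Proof.
rewrite -[spinor_act (cl_rev x) t]/(clifford_act_on t _) linear_sum.
rewrite spinor_form_suml spinor_form_sumr; apply: eq_bigr => I _.
rewrite linearZ spinor_formZl spinor_formZr; congr (_ * _).
rewrite /= /clifford_act_on spinor_act_prod.
elim: (enum I) t => //= p l IHl t.
by rewrite spinor_form_gen IHl rev_cons foldr_rcons.
Qed.

Lemma spinor_form_invariant x s t : cl_rev x * x = 1 ->
  spinor_form (spinor_act x s) (spinor_act x t) = spinor_form s t.
Proof. by move=> xx; rewrite spinor_form_rev -spinor_actM xx spinor_act1. Qed.

Lemma wedge_enum I : foldr (@wedge B n) (ebase B set0) (enum I) = ebase B I.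
Proof.
(* For the zero form, Clifford multiplication by a basis vector is the wedge. *)
rewrite -[RHS](cgen_enum 0); elim: (enum I) => //= i l ->.
rewrite /cgen [X in _ + X]big1 ?addr0 // => i' _.
by rewrite /cbeta !mxE mul0rn !if_same scale0r.
Qed.

End Spinors.

(** * The conjugate-linear structure on spinors *)

Section HalfSpinCoef.
Variables (E : fieldType) (n k : nat) (d : E).
Implicit Types (i : 'I_n) (I : {set 'I_n}).

(** The diagonal of psi: [herm_coef] on the e_i and minus [herm_cocoef] on the e_(n+i). *)
Definition herm_coef i : E := if (i < k)%N then d else 1.
Definition herm_cocoef i : E := if (i < k)%N then 1 else d.

(* The halves are exact for n = 2m and m = k mod 2; then conj_norm ^ 2 is the
   inverse of the square (2 ^ n * d ^ k / d ^ m) of the unnormalised J. *)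
Definition conj_norm : E := d ^+ n./2 / (2 ^+ n./2 * d ^+ (k + n./2)./2).

(* J e_I = conj_coef I * e_(~: I): the empty wedge, killed by e_(n+1), .., e_2n,
   must go to a multiple of the top wedge, killed by their images under J. *)
Definition conj_coef I : E :=
  conj_norm * (\prod_(i in I) ((-1) ^+ i * (2 * herm_coef i))) * (- d^-1) ^+ #|I|./2.

Hypotheses (d0 : d != 0) (two0 : 2 != 0 :> E).

(** This common product of the two weights is what makes J^2 = -d on vectors. *)
Lemma herm_coefM i : herm_coef i * herm_cocoef i = d.
Proof. by rewrite /herm_coef /herm_cocoef; case: ifP; rewrite ?mulr1 ?mul1r. Qed.

(** Because the cardinal is halved in the exponent, -1/d enters only when an element is added to an
    odd set. *)
Lemma conj_coefU1 i I : i \notin I ->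
  conj_coef (i |: I) =
    (-1) ^+ i * (2 * herm_coef i) * (if odd #|I| then - d^-1 else 1) * conj_coef I.
Proof.
move=> iI; rewrite /conj_coef big_setU1 //= cardsU1 iI /= uphalf_half exprD.
by case: odd; rewrite /= ?expr1 ?expr0; ring.
Qed.

Lemma conj_coef_neq0 I : conj_coef I != 0.
Proof.
rewrite /conj_coef /conj_norm !mulf_eq0 !invr_eq0 !mulf_eq0 !expf_eq0 oppr_eq0 invr_eq0.
rewrite (negbTE d0) (negbTE two0) !andbF /= orbF; apply/prodf_neq0 => i _.
by rewrite mulf_eq0 mulf_eq0 signr_eq0 (negbTE two0) /herm_coef; case: ifP; rewrite ?oner_eq0.
Qed.

(** This amounts to J^2 = 1 on even spinors. The products over [I] and its complement combine into
    one over all indices, independent of [I], which [conj_norm] squared and the powers of -1/d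
    cancel. *)
Lemma conj_coefC m I : n = (2 * m)%N -> (k <= n)%N -> m = k %[mod 2] ->
  ~~ odd #|I| -> conj_coef I * conj_coef (~: I) = 1.
Proof.
move=> nE kn mk eI.
have n2 : n./2 = m by rewrite nE mul2n doubleK.
have eIC : ~~ odd #|~: I|.
  have := congr1 odd (cardsC I); rewrite card_ord oddD (negbTE eI) /= => ->.
  by rewrite nE oddM.
have cI : (#|I|./2 + #|~: I|./2)%N = m.
  by have := halfD #|I| #|~: I|; rewrite (negbTE eI) add0n cardsC card_ord n2.
(* The parity hypothesis enters here: [k + m] is even, so d^k is a square divided by d^m. *)
have km : ((k + m)./2).*2 = (k + m)%N.
  rewrite -[RHS]odd_double_half oddD.
  by have := mk; rewrite !modn2 => /(congr1 odd); rewrite !oddb => ->; rewrite addbb.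
have P : (\prod_(i in I) ((-1) ^+ i * (2 * herm_coef i))) *
         (\prod_(i in ~: I) ((-1) ^+ i * (2 * herm_coef i))) =
         (-1) ^+ m * (2 ^+ m * 2 ^+ m * d ^+ k).
  transitivity (\prod_(i < n) ((-1) ^+ i * (2 * herm_coef i))).
    rewrite [RHS](bigID (fun i => i \in I)) /=; congr (_ * _).
    by apply: eq_bigl => i; rewrite inE.
  rewrite !big_split /=; congr (_ * (_ * _)).
  (* Each pair of consecutive indices 2r, 2r + 1 contributes a factor -1, and there are [m]
     pairs. *)
  - rewrite nE; elim: (m) => [|r IHr]; first by rewrite muln0 big_ord0.
    rewrite mulnS addSn addSn add0n !big_ord_recr /= IHr.
    by rewrite !exprS exprM sqrrN !expr1n; ring.
  - by rewrite big_const cardT size_enum_ord iter_mulr mulr1 nE mul2n -addnn exprD.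
  - rewrite -big_mkcond /= big_const iter_mulr mulr1; congr (_ ^+ _).
    by rewrite -[RHS](card_ord k) -!sum1_card (big_ord_narrow kn).
rewrite /conj_coef.
transitivity (conj_norm ^+ 2 * ((-1) ^+ m * (2 ^+ m * 2 ^+ m * d ^+ k)) * (- d^-1) ^+ m).
  by rewrite -P -cI exprD; ring.
rewrite /conj_norm n2 [X in _ * X]exprNn.
have kE : d ^+ k = d ^+ (k + m)./2 * d ^+ (k + m)./2 / d ^+ m.
  by rewrite -exprD addnn km exprD mulfK // expf_neq0.
have sE : (-1) ^+ m * (-1) ^+ m = 1 :> E by rewrite -expr2 sqrr_sign.
rewrite kE -exprVn -[RHS]sE exprVn.
by field; rewrite !expf_neq0.
Qed.

End HalfSpinCoef.

Section SemilinearStructure.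
Variables (E : fieldType) (conj : {rmorphism E -> E}) (n k : nat) (d : E).
Hypotheses (d0 : d != 0) (two0 : 2 != 0 :> E) (conj_d : conj d = d).
Variables (B : comNzRingType) (bar : {rmorphism B -> B}) (inj : {rmorphism E -> B}).
Hypotheses (barK : involutive bar) (bar_inj : forall e, bar (inj e) = inj (conj e)).
Implicit Types (s t : exta B n) (i : 'I_n) (p : 'I_(n + n)) (I : {set 'I_n}).
Implicit Types (v w : 'cV[B]_(n + n)) (x : cliff (gramW B n)) (a : B).

Local Notation c := (conj_coef k d).

Lemma conj_conj_coef I : conj (c I) = c I.
Proof.
rewrite /conj_coef /conj_norm !rmorphM fmorphV rmorphM !rmorphXn rmorphN fmorphV /= conj_d.
rewrite rmorph_nat rmorph_prod; congr (_ * _ * _); apply: eq_bigr => i _.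
rewrite !rmorphM rmorph_sign rmorph_nat /herm_coef.
by case: ifP; rewrite ?rmorph1 ?conj_d.
Qed.

Lemma bar_conj_coef I : bar (inj (c I)) = inj (c I).
Proof. by rewrite bar_inj conj_conj_coef. Qed.

Definition spinor_conj s : exta B n :=
  [ffun I : {set 'I_n} => inj (c (~: I)) * bar (s (~: I))].

Lemma spinor_conjD s t : spinor_conj (s + t) = spinor_conj s + spinor_conj t.
Proof. by apply/ffunP => I; rewrite !ffunE rmorphD mulrDr. Qed.

Lemma spinor_conjZ a s : spinor_conj (a *: s) = bar a *: spinor_conj s.
Proof. by apply/ffunP => I; rewrite !ffunE /GRing.scale /= rmorphM /=; ring. Qed.

Lemma spinor_conj0 : spinor_conj 0 = 0.
Proof. by apply/ffunP => I; rewrite !ffunE rmorph0 mulr0. Qed.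

Lemma spinor_conj_sum (T : finType) (f : T -> exta B n) :
  spinor_conj (\sum_u f u) = \sum_u spinor_conj (f u).
Proof. exact: (big_morph _ spinor_conjD spinor_conj0). Qed.

Lemma spinor_conj_ebase I : spinor_conj (ebase B I) = inj (c I) *: ebase B (~: I).
Proof.
apply/ffunP => J; rewrite !ffunE /GRing.scale /=.
rewrite -(inj_eq (@setC_inj _) J) setCK.
by case: eqP => [->|_]; rewrite ?rmorph1 ?rmorph0 ?mulr0.
Qed.

(** J on vectors. Since b pairs e_i with e_(n+i), writing psi through b exchanges the two halves of
    the basis. *)
Definition vector_conj v : 'cV[B]_(n + n) :=
  \col_p match split p with
         | inl i => - inj (herm_cocoef k d i) * bar (v (rshift n i) 0)
         | inr i => inj (herm_coef k d i) * bar (v (lshift n i) 0)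
         end.

Lemma split_lshift i : split (lshift n i) = inl i.
Proof. exact: (unsplitK (inl i)). Qed.
Lemma split_rshift i : split (rshift n i) = inr i.
Proof. exact: (unsplitK (inr i)). Qed.

Lemma vector_conj_lshift v i :
  vector_conj v (lshift n i) 0 = - inj (herm_cocoef k d i) * bar (v (rshift n i) 0).
Proof. by rewrite mxE split_lshift. Qed.

Lemma vector_conj_rshift v i :
  vector_conj v (rshift n i) 0 = inj (herm_coef k d i) * bar (v (lshift n i) 0).
Proof. by rewrite mxE split_rshift. Qed.

Lemma psiW_vector_conj v w : psiW bar (inj d) k v w = bW v (vector_conj w).
Proof.
rewrite /psiW !mulr_sumr -!sumrN.
rewrite !(big_mkcond (fun i : 'I_n => (i < k)%N)) !(big_mkcond (fun i : 'I_n => (k <= i)%N)).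
rewrite -!big_split; apply: eq_bigr => i _ /=.
rewrite vector_conj_rshift vector_conj_lshift /herm_coef /herm_cocoef.
by case: ltnP => _ /=; rewrite rmorph1 ?addr0 ?add0r; ring.
Qed.

Lemma bW_delta_l p v : bW (delta_mx p 0) v =
  match split p with inl i => v (rshift n i) 0 | inr i => v (lshift n i) 0 end.
Proof.
have lr i j : (lshift n i == rshift n j) = false by rewrite eq_lrshift.
have rl i j : (rshift n i == lshift n j) = false by rewrite eq_rlshift.
rewrite /bW; case: split_ordP => i ->; rewrite (bigD1 i) //= big1 => [|j ji];
  rewrite !mxE ?lr ?rl ?(inj_eq (@lshift_inj _ _)) ?(inj_eq (@rshift_inj _ _)) ?eqxx ?(negbTE ji) /=;
  by rewrite ?mul0r ?mul1r ?addr0 ?add0r.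
Qed.

Lemma bW_nondeg v w : (forall u, bW u v = bW u w) -> v = w.
Proof.
move=> vw; apply/colP => p; rewrite -(splitK p); case: (split p) => i /=.
- by have := vw (delta_mx (rshift n i) 0); rewrite !bW_delta_l split_rshift.
- by have := vw (delta_mx (lshift n i) 0); rewrite !bW_delta_l split_lshift.
Qed.

(** As psi(z, w) = b(z, J w), preserving both forms gives b(u, g J v) = b(u, J g v) for all u, and b
    is nondegenerate. *)
Lemma in_G_vector_conj (g : 'M[B]_(n + n)) v : in_G bar (inj d) k g ->
  g *m vector_conj v = vector_conj (g *m v).
Proof.
case=> g1 gb gpsi; apply: bW_nondeg => u.
(* Over a ring, the adjugate is the inverse of [g], whose determinant is 1. *)
have -> : u = g *m (\adj g *m u) by rewrite mulmxA mul_mx_adj g1 mul1mx.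
by rewrite gb -!psiW_vector_conj gpsi.
Qed.

(* On odd spinors the intertwining relation is off by the factor -1/d, since
   [vector_conj] is a similitude of ratio -d. *)
Definition parity_twist s := parity_scale 1 (inj (- d^-1)) s.

(** J e_i is a multiple of e_(n+i), which acts as twice a contraction; the recursion [conj_coefU1]
    supplies the matching coefficient. *)
Lemma spinor_conj_wedge i s :
  spinor_conj (wedge i s) =
  inj (herm_coef k d i) *: (2 *: contract i (spinor_conj (parity_twist s))).
Proof.
apply/ffunP => I; rewrite !ffunE inE /GRing.scale /=.
case: (boolP (i \in I)) => iI /=; first by rewrite rmorph0 !mulr0.
rewrite !setCU1.
have cE := conj_coefU1 k d (I := ~: I :\ i) (i := i).
rewrite setD1K ?inE ?iI // eqxx /= in cE; rewrite cE // esgn_setC.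
have bE : bar (esgn B i I) = esgn B i I by exact: rmorph_sign.
rewrite !rmorphM bE !rmorph_sign rmorph_nat /=.
have eb : bar (if odd #|~: I :\ i| then inj (- d^-1) else 1) =
          inj (if odd #|~: I :\ i| then - d^-1 else 1).
  by case: ifP; rewrite ?rmorph1 // bar_inj rmorphN fmorphV conj_d.
rewrite eb; have h : (-1) ^+ i * (-1) ^+ i = 1 :> B by rewrite -expr2 sqrr_sign.
by rewrite -[RHS]mul1r -[X in _ = X * _]h; ring.
Qed.

Lemma spinor_conj_contract i s :
  spinor_conj (2 *: contract i s) =
  - inj (herm_cocoef k d i) *: wedge i (spinor_conj (parity_twist s)).
Proof.
apply/ffunP => I; rewrite !ffunE inE /GRing.scale /=.
case: (boolP (i \in I)) => iI /=; last by rewrite mulr0 rmorph0 !mulr0.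
have -> : ~: (I :\ i) = i |: ~: I.
  by apply/setP => j; rewrite !inE negb_and negbK.
rewrite conj_coefU1 ?inE ?iI // esgn_setC cardsU1 !inE iI /=.
move: (c (~: I)) => u.
have bE : bar (esgn B i I) = esgn B i I by exact: rmorph_sign.
rewrite !rmorphM bE !rmorph_sign !rmorph_nat /=.
set r := if odd _ then - d^-1 else 1.
set r' := if _ then inj _ else 1.
(* Adding [i] changes the parity of the set, so exactly one of [r] and [r'] is -1/d, while the two
   weights multiply to d. *)
have hr : inj (herm_cocoef k d i) * inj (herm_coef k d i) * inj r * bar r' = -1.
  rewrite -!rmorphM [herm_cocoef _ _ _ * _]mulrC herm_coefM /r /r'; case: odd => /=.
    by rewrite rmorph1 mulr1 mulrN divff // rmorphN rmorph1.
  by rewrite bar_inj -rmorphM mulr1 [conj _]rmorphN fmorphV conj_d mulrN divff // rmorphN rmorph1.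
move: ((-1) ^+ i) => sg.
transitivity (inj u * (2 * (sg * esgn B i I * bar (s (i |: ~: I)))) * 1); first by rewrite mulr1.
by rewrite -[X in _ * X = _]opprK -hr; ring.
Qed.

Lemma spinor_conj_vector_act v s :
  spinor_conj (vector_act v s) = vector_act (vector_conj v) (spinor_conj (parity_twist s)).
Proof.
(* J exchanges the two halves of the basis of W, hence the swap of the two sums. *)
rewrite /vector_act spinor_conj_sum !big_split_ord /= addrC.
congr (_ + _); apply: eq_bigr => i _; rewrite spinor_conjZ.
  rewrite vector_conj_lshift /spinor_gen split_lshift split_rshift.
  by rewrite spinor_conj_contract scalerA mulrC.
rewrite vector_conj_rshift /spinor_gen split_lshift split_rshift.
by rewrite spinor_conj_wedge scalerA mulrC.
Qed.

Section EvenRank.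
Variable m : nat.
Hypotheses (nE : n = (2 * m)%N) (kn : (k <= n)%N) (mk : m = k %[mod 2]).

Let even_n : ~~ odd n. Proof. by rewrite nE oddM. Qed.

Lemma conj_coefCl I : ~~ odd #|I| -> c (~: I) * c I = 1.
Proof. by move=> eI; rewrite mulrC (conj_coefC d0 two0 nE). Qed.

Lemma spinor_conjK s : half_spin s -> spinor_conj (spinor_conj s) = s.
Proof.
move=> h; apply/ffunP => I; rewrite !ffunE setCK.
case: (boolP (odd #|I|)) => oI; first by rewrite (h _ oI) !(rmorph0, mulr0).
rewrite [bar (_ * _)]rmorphM barK bar_conj_coef mulrA -rmorphM.
by rewrite conj_coefCl // rmorph1 mul1r.
Qed.

(** J passes to complementary index sets, so the arguments trade places; the coefficients cancel by
    [conj_coefCl] because [s] is even. *)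
Lemma spinor_form_conj s t : half_spin s ->
  spinor_form (spinor_conj s) (spinor_conj t) = bar (spinor_form t s).
Proof.
move=> h; rewrite rmorph_sum; apply: eq_bigr => I _; rewrite !ffunE setCK ![bar (_ * _)]rmorphM.
have -> : bar (index_sign B I) = index_sign B I by exact: rmorph_sign.
case: (boolP (odd #|~: I|)) => oI; first by rewrite (h _ oI) !(rmorph0, mulr0, mul0r).
have cc : inj (c (~: I)) * inj (c I) = 1.
  by rewrite -rmorphM mulrC -{1}[I]setCK conj_coefCl ?rmorph1.
by rewrite -[RHS]mulr1 -cc; ring.
Qed.

Let one : exta B n := ebase B set0.

Let half_spin_one : half_spin one.
Proof. by apply: half_spin_ebase; rewrite cards0. Qed.

Let half_spin_top : half_spin (ebase B [set: 'I_n]).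
Proof. by apply: half_spin_ebase; rewrite cardsT card_ord. Qed.

(* The scalar z with x^-1 J x = z J. *)
Definition conj_ratio x : B :=
  inj (index_sign E [set: 'I_n] * c (set0 : {set 'I_n}))^-1 *
  spinor_form (spinor_conj (spinor_act x one)) (spinor_act x one).

Lemma spinor_form_conj_one :
  spinor_form (spinor_conj one) one = inj (index_sign E [set: 'I_n] * c (set0 : {set 'I_n})).
Proof.
rewrite spinor_conj_ebase spinor_formZl spinor_form_ebase setC0 setCT ffunE eqxx mulr1.
by rewrite [RHS]rmorphM rmorph_sign mulrC.
Qed.

Let ratio_unit : inj (index_sign E [set: 'I_n] * c (set0 : {set 'I_n}))^-1 *
  inj (index_sign E [set: 'I_n] * c (set0 : {set 'I_n})) = 1.
Proof. by rewrite -rmorphM mulVf ?rmorph1 // mulf_neq0 ?signr_eq0 // conj_coef_neq0. Qed.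

Lemma vector_conj_delta_rshift i : vector_conj (delta_mx (rshift n i) 0) =
  - inj (herm_cocoef k d i) *: delta_mx (lshift n i) 0.
Proof.
apply/colP => q; rewrite -(splitK q); case: (split q) => j /=; rewrite [RHS]mxE.
  rewrite vector_conj_lshift !mxE (inj_eq (@lshift_inj _ _)) (inj_eq (@rshift_inj _ _)).
  by rewrite rmorph_nat; case: eqP => [->|_] //=; rewrite !mulr0.
by rewrite vector_conj_rshift !mxE eq_lrshift eq_rlshift /= rmorph0 !mulr0.
Qed.

Lemma vector_actZ a v s : vector_act (a *: v) s = a *: vector_act v s.
Proof. by rewrite scaler_sumr; apply: eq_bigr => p _; rewrite mxE scalerA. Qed.

Lemma vector_act_scale a v s : vector_act v (a *: s) = a *: vector_act v s.
Proof. by rewrite -!spinor_act_vec linearZ. Qed.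

(** * Conjugating J by an element of the preimage of G *)

Section Preimage.
Variable x : cliff (gramW B n).
Hypothesis hx : spin_preimage bar (inj d) k x.

Let xe : cl_even x. Proof. by case: hx => [[]]. Qed.
Let xV : x * cl_rev x = 1. Proof. by case: hx => [[]]. Qed.
Let Vx : cl_rev x * x = 1. Proof. by case: hx => [[]]. Qed.

(** This is x^-1 J x, since [cl_rev x] is the inverse of [x]. *)
Let R s := spinor_act (cl_rev x) (spinor_conj (spinor_act x s)).

Let xR s : spinor_act x (R s) = spinor_conj (spinor_act x s).
Proof. by rewrite -spinor_actM xV spinor_act1. Qed.

Let RZ a s : R (a *: s) = bar a *: R s.
Proof. by rewrite /R linearZ spinor_conjZ linearZ. Qed.

Let Rsum (T : finType) (f : T -> exta B n) : R (\sum_u f u) = \sum_u R (f u).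
Proof. by rewrite /R linear_sum spinor_conj_sum linear_sum. Qed.

(** R obeys the same intertwining relation as J: [x] acts on vectors through some [g] in G, and [g]
    commutes with J. *)
Let R_vector v s : R (vector_act v s) = vector_act (vector_conj v) (R (parity_twist s)).
Proof.
have [_ [g hg gx]] := hx.
have xv u : x * cl_vec (gramW B n) u = cl_vec (gramW B n) (g *m u) * x.
  by rewrite -gx -mulrA Vx mulr1.
have vx u : cl_rev x * cl_vec (gramW B n) (g *m u) = cl_vec (gramW B n) u * cl_rev x.
  by rewrite -gx -mulrA !mulrA Vx mul1r.
rewrite /R -(spinor_act_vec v) -spinor_actM xv spinor_actM spinor_act_vec.
rewrite spinor_conj_vector_act -(in_G_vector_conj _ hg) -spinor_act_vec -spinor_actM vx.
by rewrite spinor_actM spinor_act_vec /parity_twist -spinor_act_parity_scale.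
Qed.

(* Contractions kill 1, so the images J e_(n+i), multiples of e_i, kill R 1:
   it is a multiple of the top wedge. *)
Let R_one : R one = conj_ratio x *: spinor_conj one.
Proof.
have tw1 : parity_twist one = one.
  by rewrite /parity_twist parity_scale_ebase cards0 scale1r.
have w0 i : wedge i (R one) = 0.
  have := R_vector (delta_mx (rshift n i) 0) one.
  rewrite tw1 vector_conj_delta_rshift vector_actZ !vector_act_delta.
  rewrite /spinor_gen split_lshift split_rshift.
  have -> : contract i one = 0.
    apply/ffunP => I; rewrite !ffunE; case: ifP => // _.
    by case: eqP => [I0|]; rewrite ?mulr0 //; have := setU11 i I; rewrite I0 inE.
  rewrite scaler0 {1}/R linear0 spinor_conj0 linear0 => /(congr1 (fun y => - inj (herm_cocoef k d i)^-1 *: y)).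
  rewrite scaler0 scalerA mulNr mulrN opprK -rmorphM mulVf ?rmorph1 ?scale1r //.
  by rewrite /herm_cocoef; case: ifP; rewrite ?oner_eq0.
pose z := inj (c (set0 : {set 'I_n}))^-1 * R one [set: 'I_n].
have RE : R one = z *: spinor_conj one.
  rewrite spinor_conj_ebase scalerA mulrAC -rmorphM mulVf ?conj_coef_neq0 //.
  rewrite rmorph1 mul1r setC0; apply/ffunP => I; rewrite !ffunE /GRing.scale /=.
  have [->|IT] := eqVneq I setT; first by rewrite mulr1.
  (* For [i] outside [I], the coefficient of [R one] at [I] is, up to sign, that of
     [wedge i (R one)] at [i |: I], which vanishes. *)
  rewrite mulr0; have [i iI] : exists i, i \notin I.
    by apply/existsP; rewrite -negb_forall; apply: contraNN IT => /forallP h; apply/eqP/setP => i; rewrite h inE.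
  have := w0 i => /ffunP/(_ (i |: I)); rewrite !ffunE setU11 setU1K //.
  move/(congr1 (fun y => esgn B i (i |: I) * y)).
  by rewrite mulrA esgn_sq mul1r mulr0.
(* Invariance under [x] turns the form in [conj_ratio x] into that of [R one] and [one], which is
   [z] times the normalising value. *)
rewrite RE; congr (_ *: _); rewrite /conj_ratio -xR spinor_form_invariant //.
by rewrite RE spinor_formZl spinor_form_conj_one mulrCA ratio_unit mulr1.
Qed.

(** R and J satisfy the same intertwining relation and are proportional on 1, from which wedges
    produce all spinors. *)
Let R_all s : R s = conj_ratio x *: spinor_conj s.
Proof.
(* Arbitrary parity scalars are carried along because each wedge introduces a twist of the shorter
   word. *)
have Rw l a b : R (parity_scale a b (foldr (@wedge B n) one l)) =
    conj_ratio x *: spinor_conj (parity_scale a b (foldr (@wedge B n) one l)).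
  elim: l a b => [|i l IHl] a b /=.
    by rewrite parity_scale_ebase cards0 /= RZ R_one spinor_conjZ !scalerA mulrC.
  have wE y : wedge i y = vector_act (delta_mx (lshift n i) 0) y.
    by rewrite vector_act_delta /spinor_gen split_lshift.
  have -> : parity_scale a b (wedge i (foldr (@wedge B n) one l)) =
            wedge i (parity_scale b a (foldr (@wedge B n) one l)).
    by rewrite !wE !vector_act_delta spinor_gen_parity_scale.
  rewrite wE R_vector spinor_conj_vector_act /parity_twist.
  by rewrite parity_scale_comp IHl vector_act_scale.
rewrite [s]exta_sum Rsum spinor_conj_sum scaler_sumr; apply: eq_bigr => I _.
have e1 : parity_scale 1 1 (ebase B I) = ebase B I.
  by rewrite parity_scale_ebase if_same scale1r.
rewrite RZ spinor_conjZ -e1 -(wedge_enum B I) Rw.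
by rewrite !scalerA mulrC.
Qed.

(** R^2 = x^-1 J^2 x is the identity on S^+, whereas R = z J gives R^2 = z conj(z). *)
Lemma conj_ratio_norm : conj_ratio x * bar (conj_ratio x) = 1.
Proof.
have hxs s : half_spin s -> half_spin (spinor_act x s) by apply: half_spin_act.
have : R (R one) = one.
  by rewrite /R xR spinor_conjK -?spinor_actM ?Vx ?spinor_act1 //; apply: hxs.
rewrite !R_all spinor_conjZ spinor_conjK // scalerA => /ffunP/(_ set0).
by rewrite !ffunE eqxx /GRing.scale /= mulr1.
Qed.

(** R transforms the invariant form as J does, because [x] preserves it; R = z J adds a factor z^2.
    Comparing on 1 and the top wedge, which pair to a sign, gives the claim. *)
Lemma conj_ratio_sqr : conj_ratio x * conj_ratio x = 1.
Proof.
have hxs s : half_spin s -> half_spin (spinor_act x s) by apply: half_spin_act.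
pose top : exta B n := ebase B [set: 'I_n].
have fR : spinor_form (R one) (R top) = bar (spinor_form top one).
  apply: (etrans (esym (spinor_form_invariant (R one) (R top) Vx))).
  apply: (etrans (congr2 (@spinor_form B n) (xR one) (xR top))).
  rewrite spinor_form_conj; last exact: hxs.
  by rewrite spinor_form_invariant.
move: fR; rewrite !R_all spinor_formZl spinor_formZr spinor_form_conj //.
rewrite spinor_form_ebase setCT ffunE eqxx mulr1 mulrA.
have -> : bar (index_sign B [set: 'I_n]) = index_sign B [set: 'I_n] by exact: rmorph_sign.
move/(congr1 (fun y => y * index_sign B [set: 'I_n])).
have sq : index_sign B [set: 'I_n] * index_sign B [set: 'I_n] = 1.
  by rewrite -expr2 sqrr_sign.
by rewrite -mulrA sq mulr1.
Qed.

Lemma bar_conj_ratio : bar (conj_ratio x) = conj_ratio x.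
Proof. by rewrite -[LHS]mul1r -conj_ratio_sqr -mulrA conj_ratio_norm mulr1. Qed.

Lemma spinor_conj_act s : conj_ratio x = 1 ->
  spinor_conj (spinor_act x s) = spinor_act x (spinor_conj s).
Proof. by move=> z1; rewrite -(xR s) R_all z1 scale1r. Qed.

End Preimage.

Lemma conj_ratio1 : conj_ratio 1 = 1.
Proof. by rewrite /conj_ratio !spinor_act1 spinor_form_conj_one ratio_unit. Qed.

End EvenRank.
End SemilinearStructure.

(** * Base change and a basis of fixed spinors *)

Lemma exta_scaleE (B : comNzRingType) N a (s : exta B N) I : (a *: s) I = a * s I.
Proof. by rewrite ffunE. Qed.

Section BaseChange.
Variables (B B' : comNzRingType) (f : {rmorphism B -> B'}).

Definition exta_map (N : nat) (s : exta B N) : exta B' N :=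
  [ffun I : {set 'I_N} => f (s I)].

Lemma exta_mapE N (s : exta B N) I : exta_map s I = f (s I).
Proof. by rewrite ffunE. Qed.

Lemma exta_mapD N (s t : exta B N) : exta_map (s + t) = exta_map s + exta_map t.
Proof. by apply/ffunP => I; rewrite !ffunE rmorphD. Qed.

Lemma exta_mapZ N a (s : exta B N) : exta_map (a *: s) = f a *: exta_map s.
Proof. by apply/ffunP => I; rewrite !ffunE /GRing.scale /= rmorphM. Qed.

Lemma exta_map0 N : exta_map (0 : exta B N) = 0.
Proof. by apply/ffunP => I; rewrite !ffunE rmorph0. Qed.

Lemma exta_map_ebase N (I : {set 'I_N}) : exta_map (ebase B I) = ebase B' I.
Proof. by apply/ffunP => J; rewrite !ffunE rmorph_nat. Qed.

Lemma exta_map_spinor_gen n p (s : exta B n) :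
  exta_map (spinor_gen p s) = spinor_gen p (exta_map s).
Proof.
rewrite /spinor_gen; case: split => i; rewrite ?exta_mapZ ?rmorph_nat.
  apply/ffunP => I; rewrite !ffunE; case: ifP => _; rewrite ?rmorph0 //.
  by rewrite rmorphM; congr (_ * _); apply: rmorph_sign.
congr (_ *: _); apply/ffunP => I; rewrite !ffunE; case: ifP => _; rewrite ?rmorph0 //.
by rewrite rmorphM; congr (_ * _); apply: rmorph_sign.
Qed.

Lemma exta_map_spinor_act n (x : cliff (gramW B n)) (x' : cliff (gramW B' n)) (s : exta B n) :
  (forall I, x' I = f (x I)) ->
  exta_map (spinor_act x s) = spinor_act x' (exta_map s).
Proof.
move=> xx'; rewrite /spinor_act /cact (big_morph _ (@exta_mapD n) (@exta_map0 n)).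
apply: eq_bigr => I _; rewrite exta_mapZ xx'; congr (_ *: _).
by elim: (enum I) => //= p l <-; rewrite exta_map_spinor_gen.
Qed.

Lemma spinor_form_exta_map n (s t : exta B n) :
  f (spinor_form s t) = spinor_form (exta_map s) (exta_map t).
Proof.
rewrite rmorph_sum; apply: eq_bigr => I _; rewrite !ffunE !rmorphM.
by congr (_ * _ * _); apply: rmorph_sign.
Qed.

Variables (E : fieldType) (n k : nat) (d : E).
Variables (bar : {rmorphism B -> B}) (inj : {rmorphism E -> B}).
Variables (bar' : {rmorphism B' -> B'}) (inj' : {rmorphism E -> B'}).
Hypotheses (f_inj : forall e, f (inj e) = inj' e) (f_bar : forall a, f (bar a) = bar' (f a)).

Lemma exta_map_spinor_conj (s : exta B n) :
  exta_map (spinor_conj k d bar inj s) = spinor_conj k d bar' inj' (exta_map s).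
Proof. by apply/ffunP => I; rewrite !ffunE -f_bar -f_inj -rmorphM. Qed.

(** The explicit formula for the scalar in terms of [spinor_form] makes it natural in the base,
    hence a function on the group scheme. *)
Lemma conj_ratio_exta_map (x : cliff (gramW B n)) (x' : cliff (gramW B' n)) :
  (forall I, x' I = f (x I)) ->
  f (conj_ratio k d bar inj x) = conj_ratio k d bar' inj' x'.
Proof.
move=> xx'; rewrite /conj_ratio rmorphM spinor_form_exta_map f_inj exta_map_spinor_conj.
by rewrite (exta_map_spinor_act _ xx') exta_map_ebase.
Qed.

End BaseChange.

(** * A basis of S^+ fixed by J and its coordinates *)

Section RealBasis.
Variables (E : fieldType) (conj : {rmorphism E -> E}) (n k : nat) (d : E).
Hypotheses (d0 : d != 0) (two0 : 2 != 0 :> E) (conj_d : conj d = d).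
Variables (alpha : E) (i0 : 'I_n).
Hypotheses (alpha0 : alpha != 0) (conj_alpha : conj alpha = - alpha).
Variable m : nat.
Hypotheses (nE : n = (2 * m)%N) (kn : (k <= n)%N) (mk : m = k %[mod 2]).
Implicit Types (I J : {set 'I_n}).

Local Notation c := (conj_coef k d).

Definition real_weight I : E := if i0 \in I then alpha else 1.

Lemma real_weight_neq0 I : real_weight I != 0.
Proof. by rewrite /real_weight; case: ifP; rewrite ?oner_eq0. Qed.

Lemma conj_real_weight I :
  conj (real_weight I) = if i0 \in I then - alpha else 1.
Proof. by rewrite /real_weight; case: ifP; rewrite ?rmorph1. Qed.

Lemma conj_real_weightK I : conj (conj (real_weight I)) = real_weight I.
Proof.
by rewrite conj_real_weight /real_weight; case: ifP; rewrite ?rmorph1 // rmorphN conj_alpha opprK.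
Qed.

Lemma conj_real_weight_neq0 I : conj (real_weight I) != 0.
Proof. by rewrite fmorph_eq0 real_weight_neq0. Qed.

(* t + J t for t = e_I if i0 \notin I and t = alpha * e_I otherwise: from each
   pair {I, ~: I}, one "real" and one "imaginary" vector fixed by J. *)
Definition real_basis I : exta E n :=
  real_weight I *: ebase E I + (conj (real_weight I) * c I) *: ebase E (~: I).

Lemma real_basisE I K : real_basis I K =
  real_weight I * (K == I)%:R + conj (real_weight I) * c I * (K == ~: I)%:R.
Proof. by rewrite !ffunE. Qed.

Lemma odd_setC I : odd #|~: I| = odd #|I|.
Proof.
have := congr1 odd (cardsC I); rewrite card_ord oddD.
have -> : odd n = false by rewrite nE oddM.
by case: odd; case: odd.
Qed.

Lemma half_spin_real_basis I : ~~ odd #|I| -> half_spin (real_basis I).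
Proof.
move=> eI K oK; rewrite real_basisE; case: eqP oK => [->|_]; first by rewrite (negbTE eI).
case: eqP => [->|_]; first by rewrite odd_setC (negbTE eI).
by rewrite !mulr0 addr0.
Qed.

Lemma neq_setC I : (I == ~: I) = false.
Proof. by apply/eqP => /setP/(_ i0); rewrite inE; case: (i0 \in I). Qed.

Section Coordinates.
Variables (B : comNzRingType) (bar : {rmorphism B -> B}) (inj : {rmorphism E -> B}).
Hypotheses (barK : involutive bar) (bar_inj : forall e, bar (inj e) = inj (conj e)).
Implicit Types (s t : exta B n).

(** The functional dual to [real_basis I], found by solving the two-by-two linear system on the
    coefficients at [I] and [~: I]. *)
Definition real_coord I t : B :=
  inj 2^-1 * (inj (real_weight I)^-1 * t I +
              inj (c (~: I) / conj (real_weight I)) * t (~: I)).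

Lemma real_coordD I s t : real_coord I (s + t) = real_coord I s + real_coord I t.
Proof. by rewrite /real_coord !ffunE; ring. Qed.

Lemma real_coordZ I a t : real_coord I (a *: t) = a * real_coord I t.
Proof. by rewrite /real_coord !ffunE /GRing.scale /=; ring. Qed.

Lemma real_coord0 I : real_coord I 0 = 0.
Proof. by rewrite /real_coord !ffunE !mulr0 addr0 mulr0. Qed.

Lemma real_coord_sum (T : finType) (P : pred T) I (g : T -> exta B n) :
  real_coord I (\sum_(u | P u) g u) = \sum_(u | P u) real_coord I (g u).
Proof. exact: (big_morph _ (real_coordD I) (real_coord0 I)). Qed.

Lemma real_coord_basis I J : ~~ odd #|I| ->
  real_coord I (exta_map inj (real_basis J)) = (I == J)%:R.
Proof.
move=> eI; have cc := conj_coefC d0 two0 nE kn mk eI.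
rewrite /real_coord !exta_mapE -!rmorphM -rmorphD -rmorphM -[RHS](rmorph_nat inj).
congr (inj _); rewrite !real_basisE.
have [<-|IJ] := eqVneq I J.
  rewrite neq_setC eq_sym neq_setC eqxx /= mulr1n mulr0n.
  have := real_weight_neq0 I; have := conj_real_weight_neq0 I.
  move: cc; move: (c I) (c (~: I)) (real_weight I) (conj _) => u v w w' uv w'0 w0.
  (* On the diagonal both terms equal 1, the second by [conj_coefC]; hence the factor 1/2. *)
  transitivity (2^-1 * (1 + u * v)); first by field; rewrite two0 w0 w'0.
  by rewrite uv -[1 + 1]/2 mulVf.
rewrite (inj_eq (@setC_inj _)) (negbTE IJ) -(inj_eq (@setC_inj _) (~: I)) setCK.
rewrite /= mulr0n; have [->|_] := eqVneq I (~: J); last by rewrite !(mulr0, addr0).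
rewrite setCK !conj_real_weight /real_weight inE mulr1n.
(* Of two complementary sets one has weight [alpha] and the other 1; the contributions cancel as
   [conj] negates [alpha]. *)
by case: (i0 \in J) => /=; field; rewrite ?oppr_eq0 ?oner_eq0 ?alpha0 ?two0.
Qed.

Lemma real_coord_expand t : half_spin t ->
  t = \sum_(I : {set 'I_n} | ~~ odd #|I|) real_coord I t *: exta_map inj (real_basis I).
Proof.
move=> ht; apply/ffunP => K; rewrite sum_ffunE.
case: (boolP (odd #|K|)) => oK.
  rewrite ht // big1 // => I eI; rewrite exta_scaleE exta_mapE.
  by rewrite half_spin_real_basis // rmorph0 mulr0.
have oKC : ~~ odd #|~: K| by rewrite odd_setC.
(* Only the basis vectors of [K] and [~: K] have a nonzero coefficient at [K]. *)
rewrite (bigD1 K) //= (bigD1 (~: K)) /=; last by rewrite oKC eq_sym neq_setC.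
rewrite big1 => [|I /andP[/andP[_ IK] IKC]]; last first.
  rewrite exta_scaleE exta_mapE real_basisE.
  rewrite [K == I]eq_sym (negbTE IK) -(inj_eq (@setC_inj _) K) setCK eq_sym (negbTE IKC).
  by rewrite !(mulr0, addr0, rmorph0).
rewrite [X in _ + X]addr0 (exta_scaleE (real_coord K t)) (exta_scaleE (real_coord (~: K) t)).
rewrite 2!exta_mapE !real_basisE setCK eqxx neq_setC /real_coord setCK.
rewrite !(mulr0, mulr1, addr0, add0r).
have cc : inj (c (~: K)) * inj (c K) = 1.
  by rewrite -rmorphM mulrC (conj_coefC d0 two0 nE kn mk oK) rmorph1.
have h2 : inj 2^-1 * 2 = 1 by rewrite -(rmorph_nat inj) -rmorphM mulVf ?rmorph1.
have ha : inj alpha * inj alpha^-1 = 1 by rewrite -rmorphM divff ?rmorph1.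
move: cc; move: (c K) (c (~: K)) => u v cc.
rewrite !conj_real_weight /real_weight inE.
case: (i0 \in K) => /=; rewrite ?invrN ?invr1 !(mulrN, mulr1, mul1r, rmorphN, rmorph1, rmorphM).
  transitivity (inj 2^-1 * ((inj alpha * inj alpha^-1) * t K + (inj v * inj u) * t K +
    (1 - inj alpha * inj alpha^-1) * inj v * t (~: K))); last by ring.
  by rewrite cc ha subrr !mul0r addr0 mul1r -mulr2n -[t K *+ 2]mulr_natl mulrA h2 mul1r.
transitivity (inj 2^-1 * (t K + (inj v * inj u) * (inj alpha * inj alpha^-1) * t K +
  (1 - inj alpha * inj alpha^-1) * inj v * t (~: K))); last by ring.
by rewrite cc ha subrr !mul0r addr0 !mul1r -mulr2n -[t K *+ 2]mulr_natl mulrA h2 mul1r.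
Qed.

(** Consequently the coordinates of a spinor fixed by J are fixed by [bar]. *)
Lemma bar_real_coord I t : ~~ odd #|I| ->
  bar (real_coord I t) = real_coord I (spinor_conj k d bar inj t).
Proof.
move=> eI; rewrite /real_coord !ffunE setCK.
have cc : inj (c (~: I)) * inj (c I) = 1.
  by rewrite -rmorphM mulrC (conj_coefC d0 two0 nE kn mk eI) rmorph1.
rewrite [LHS]rmorphM rmorphD ![bar (_ * _)]rmorphM !bar_inj.
have conj_c J : conj (c J) = c J by exact: conj_conj_coef.
have -> : conj (c (~: I) / conj (real_weight I)) = c (~: I) / real_weight I.
  by rewrite rmorphM fmorphV conj_c conj_real_weightK.
have -> : conj (2^-1) = 2^-1 by rewrite fmorphV rmorph_nat.
have -> : conj (real_weight I)^-1 = (conj (real_weight I))^-1 by rewrite fmorphV.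
rewrite ![inj (c _ / _)]rmorphM; congr (_ * _).
rewrite [in RHS]addrC; congr (_ + _); last by ring.
by rewrite -[LHS]mul1r -cc; ring.
Qed.

Lemma spinor_conj_real_basis I : ~~ odd #|I| ->
  spinor_conj k d bar inj (exta_map inj (real_basis I)) = exta_map inj (real_basis I).
Proof.
move=> eI; rewrite /real_basis exta_mapD !exta_mapZ !exta_map_ebase.
rewrite spinor_conjD !spinor_conjZ !spinor_conj_ebase !scalerA setCK !bar_inj.
have conj_c J : conj (c J) = c J by exact: conj_conj_coef.
rewrite [conj (_ * _)]rmorphM conj_c conj_real_weightK addrC -!rmorphM -mulrA.
by rewrite (conj_coefC d0 two0 nE kn mk eI) mulr1.
Qed.

End Coordinates.

Lemma real_coord_exta_map (B B' : comNzRingType) (f : {rmorphism B -> B'})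
    (inj : {rmorphism E -> B}) (inj' : {rmorphism E -> B'}) I (t : exta B n) :
  (forall e, f (inj e) = inj' e) ->
  f (real_coord inj I t) = real_coord inj' I (exta_map f t).
Proof. by move=> fi; rewrite /real_coord !ffunE rmorphM rmorphD !rmorphM !fi. Qed.

End RealBasis.

(** * Quadratic extensions and tensor products *)

Section QuadraticExtension.
Variables (F : fieldType) (E : fieldExtType F) (conj : {lrmorphism E -> E}).
Hypotheses (dimE : \dim {:E} = 2%N) (conj_nontrivial : exists a, conj a <> a).
Hypothesis (two0 : 2 != 0 :> F).

Lemma coord_pair_1 (a : E) : a \notin <[1]>%VS ->
  exists l0 l1 : {linear E -> F^o},
    l0 1 = 1 /\ forall e, e = l0 e *: 1 + l1 e *: a.
Proof.
move=> a1; pose X := [tuple a; 1].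
have frX : free X by rewrite free_cons span_seq1 a1 seq1_free oner_eq0.
have bX : basis_of {:E} X by rewrite basisEfree frX subvf dimE.
pose l0 : {linear E -> F^o} := coord X (lift ord0 ord0).
pose l1 : {linear E -> F^o} := coord X ord0.
exists l0, l1; split.
  by have := coord_free (lift ord0 ord0) (lift ord0 ord0) frX; rewrite eqxx.
move=> e; rewrite {1}(coord_basis bX (memvf e)) !big_ord_recl big_ord0 addr0 /=.
by rewrite addrC.
Qed.

(** [a] and [conj a] are distinct roots of one quadratic over [F], so their sum is the coefficient
    [p] in [F], and [conj] negates their difference [alpha]. *)
Lemma quadratic_split : exists (alpha : E) (l0 l1 : {linear E -> F^o}),
  [/\ alpha != 0, conj alpha = - alpha, l0 1 = 1 &
      forall e, e = l0 e *: 1 + l1 e *: alpha].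
Proof.
have [a ca] := conj_nontrivial.
have conj1 (r : F) : conj (r *: 1) = r *: 1 by rewrite linearZ rmorph1.
have a1 : a \notin <[1]>%VS by apply/negP => /vlineP[r ar]; apply: ca; rewrite ar conj1.
have [l0 [l1 [_ le]]] := coord_pair_1 a1.
pose alpha := conj a - a.
have alpha0 : alpha != 0 by rewrite subr_eq0; apply/eqP.
have a2 := le (a * a); move: (l0 _ : F) (l1 _ : F) a2 => q p a2.
have tr : conj a + a = p *: 1.
  apply: (mulfI alpha0); rewrite -scalerAr mulr1.
  have ca2 : conj a * conj a = q *: 1 + p *: conj a.
    by rewrite -rmorphM a2 rmorphD /= conj1 linearZ.
  transitivity (conj a * conj a - a * a); first by rewrite /alpha; ring.
  by rewrite ca2 a2 opprD addrACA subrr add0r -scalerBr.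
have conj_alpha : conj alpha = - alpha.
  have caE : conj a = p *: 1 - a by rewrite -tr addrK.
  by rewrite /alpha {1}caE !linearB /= conj1 caE; ring.
(* An [alpha] in [F] would be both fixed and negated by [conj], contradicting that 2 is nonzero. *)
have alpha1 : alpha \notin <[1]>%VS.
  apply/negP => /vlineP[r ar]; move: conj_alpha; rewrite ar conj1 => /eqP.
  rewrite -subr_eq0 opprK -ar -mulr2n -scaler_nat scaler_eq0 (negbTE alpha0).
  by rewrite (negbTE two0).
have [l0' [l1' [? ?]]] := coord_pair_1 alpha1.
by exists alpha, l0', l1'.
Qed.

End QuadraticExtension.

(** * Morphisms of E (x) A and descent from E (x) A to A *)

Section TensorFacts.
Variables (F : fieldType) (E : fieldExtType F).
Implicit Types (A : comAlgType F) (e : E).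

Lemma tpure0l A (a : A) : tpure (0 : E) a = 0.
Proof. by apply/rowP=> l; rewrite !mxE linear0 scale0r. Qed.

Lemma tpure0r A e : tpure e (0 : A) = 0.
Proof. by apply/rowP=> l; rewrite !mxE scaler0. Qed.

Lemma tpure_suml A (I : finType) (g : I -> E) (a : A) :
  tpure (\sum_i g i) a = \sum_i tpure (g i) a.
Proof. by apply: (big_morph (fun e => tpure e a)) => [e f|]; rewrite ?tpureDl ?tpure0l. Qed.

Lemma tpure_sumr A (I : finType) e (g : I -> A) :
  tpure e (\sum_i g i) = \sum_i tpure e (g i).
Proof. by apply: (big_morph (tpure e)) => [a b|]; rewrite ?tpureDr ?tpure0r. Qed.

Lemma tens_morph_pure A (B : comNzRingType) (f : tens E A -> B) :
  (forall x y, f (x + y) = f x + f y) ->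
  (forall e e' (a a' : A), f (tpure e a * tpure e' a') = f (tpure e a) * f (tpure e' a')) ->
  forall x y, f (x * y) = f x * f y.
Proof.
move=> fD fM x y.
have f0 : f 0 = 0 by apply: (addIr (f 0)); rewrite -fD !add0r.
have fS (I : finType) (g : I -> tens E A) : f (\sum_i g i) = \sum_i f (g i).
  exact: (big_morph f fD f0).
rewrite [x]tpure_sum [y]tpure_sum mulr_suml !fS mulr_suml.
apply: eq_bigr => i _; rewrite mulr_sumr !fS mulr_sumr.
by apply: eq_bigr => j _; apply: fM.
Qed.

Lemma tens_pure_ext A (V : zmodType) (f g : {additive tens E A -> V}) :
  (forall e (a : A), f (tpure e a) = g (tpure e a)) -> f =1 g.
Proof.
by move=> fg x; rewrite [x]tpure_sum !raddf_sum; apply: eq_bigr => i _; apply: fg.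
Qed.

Fact tens_inl_zmod A : zmod_morphism (@tens_inl F E A).
Proof.
move=> e e'; apply/rowP=> l; rewrite !mxE linearB /=.
by rewrite scalerBl.
Qed.

Fact tens_inl_monoid A : monoid_morphism (@tens_inl F E A).
Proof. by split=> // e e'; rewrite /tens_inl tens_mulE mulr1. Qed.

HB.instance Definition _ A :=
  GRing.isZmodMorphism.Build E (tens E A) (@tens_inl F E A) (@tens_inl_zmod A).
HB.instance Definition _ A :=
  GRing.isMonoidMorphism.Build E (tens E A) (@tens_inl F E A) (@tens_inl_monoid A).

Fact tens_inr_zmod A : zmod_morphism (@tens_inr F E A).
Proof. by move=> a a'; apply/rowP=> l; rewrite !mxE scalerBr. Qed.

Fact tens_inr_monoid A : monoid_morphism (@tens_inr F E A).
Proof. by split=> // a a'; rewrite /tens_inr tens_mulE mulr1. Qed.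

HB.instance Definition _ A :=
  GRing.isZmodMorphism.Build A (tens E A) (@tens_inr F E A) (@tens_inr_zmod A).
HB.instance Definition _ A :=
  GRing.isMonoidMorphism.Build A (tens E A) (@tens_inr F E A) (@tens_inr_monoid A).

Lemma tens_map_pure A A' (phi : {lrmorphism A -> A'}) e (a : A) :
  tens_map phi (tpure e a) = tpure e (phi a).
Proof. by apply/rowP=> l; rewrite !mxE linearZ. Qed.

Fact tens_map_zmod A A' (phi : {lrmorphism A -> A'}) :
  zmod_morphism (@tens_map F E A A' phi).
Proof. by move=> x y; apply/rowP=> l; rewrite !mxE rmorphB. Qed.

Fact tens_map_monoid A A' (phi : {lrmorphism A -> A'}) :
  monoid_morphism (@tens_map F E A A' phi).
Proof.
split; first by rewrite -[1]/(tpure 1 1) tens_map_pure rmorph1.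
apply: tens_morph_pure => [x y|e e' a a'].
  by apply/rowP=> l; rewrite !mxE rmorphD.
by rewrite !tens_mulE !tens_map_pure rmorphM tens_mulE.
Qed.

HB.instance Definition _ A A' (phi : {lrmorphism A -> A'}) :=
  GRing.isZmodMorphism.Build (tens E A) (tens E A') (@tens_map F E A A' phi)
    (tens_map_zmod phi).
HB.instance Definition _ A A' (phi : {lrmorphism A -> A'}) :=
  GRing.isMonoidMorphism.Build (tens E A) (tens E A') (@tens_map F E A A' phi)
    (tens_map_monoid phi).

Variable conj : {lrmorphism E -> E}.

Lemma tens_mapl_pure A e (a : A) : tens_mapl conj (tpure e a) = tpure (conj e) a.
Proof.
rewrite /tens_mapl {2}[e](coord_vbasis (memvf e)) linear_sum tpure_suml.
by apply: eq_bigr => i _; rewrite mxE linearZ /= tpureZ.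
Qed.

Fact tens_mapl_zmod A : zmod_morphism (@tens_mapl F E A conj).
Proof.
move=> x y; rewrite /tens_mapl -sumrB; apply: eq_bigr => i _.
by rewrite !mxE tpureDr; congr (_ + _); apply/rowP=> l; rewrite !mxE scalerN.
Qed.

Fact tens_mapl_monoid A : monoid_morphism (@tens_mapl F E A conj).
Proof.
split; first by rewrite -[1]/(tpure 1 1) tens_mapl_pure rmorph1.
apply: tens_morph_pure => [x y|e e' a a'].
  by rewrite /tens_mapl -big_split; apply: eq_bigr => i _; rewrite !mxE tpureDr.
by rewrite !tens_mulE !tens_mapl_pure rmorphM tens_mulE.
Qed.

(** A named copy of [tens_mapl conj] that carries the ring morphism structure. *)
Definition tens_conj A : tens E A -> tens E A := tens_mapl conj.

HB.instance Definition _ A :=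
  GRing.isZmodMorphism.Build (tens E A) (tens E A) (@tens_conj A) (@tens_mapl_zmod A).
HB.instance Definition _ A :=
  GRing.isMonoidMorphism.Build (tens E A) (tens E A) (@tens_conj A) (@tens_mapl_monoid A).

Lemma tens_conj_pure A e (a : A) : tens_conj (tpure e a) = tpure (conj e) a.
Proof. exact: tens_mapl_pure. Qed.

Lemma tens_conj_inl A e : tens_conj (tens_inl A e) = tens_inl A (conj e).
Proof. exact: tens_mapl_pure. Qed.

Lemma tens_map_inl A A' (phi : {lrmorphism A -> A'}) e :
  tens_map phi (tens_inl A e) = tens_inl A' e.
Proof. by rewrite /tens_inl tens_map_pure rmorph1. Qed.

Lemma tens_map_conj A A' (phi : {lrmorphism A -> A'}) (x : tens E A) :
  tens_map phi (tens_conj x) = tens_conj (tens_map phi x).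
Proof.
apply: (tens_pure_ext (f := tens_map phi \o @tens_conj A)
  (g := @tens_conj A' \o tens_map phi)) => e a.
by rewrite /= tens_conj_pure !tens_map_pure tens_conj_pure.
Qed.

Variables (alpha : E) (l0 l1 : {linear E -> F^o}).
Hypotheses (alpha0 : alpha != 0) (conj_alpha : conj alpha = - alpha).
Hypotheses (l01 : l0 1 = 1) (le : forall e, e = l0 e *: 1 + l1 e *: alpha).
Hypothesis two0 : 2 != 0 :> F.

Lemma conjK : involutive conj.
Proof.
move=> e; rewrite {2}[e]le [e in LHS]le !linearD !linearZ /= !rmorph1 conj_alpha.
by rewrite linearN /= conj_alpha opprK.
Qed.

Lemma tens_conjK A : involutive (@tens_conj A).
Proof.
apply: (tens_pure_ext (f := @tens_conj A \o @tens_conj A) (g := idfun)) => e a.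
by rewrite /= !tens_conj_pure conjK.
Qed.

(** This is l (x) id_A. *)
Definition tens_functional (l : {linear E -> F^o}) A (x : tens E A) : A :=
  \sum_(i < \dim {:E}) (l (vbasis {:E})`_i : F) *: x 0 i.

Lemma tens_functional_pure l A e (a : A) :
  tens_functional l (tpure e a) = (l e : F) *: a.
Proof.
rewrite /tens_functional {2}[e](coord_vbasis (memvf e)) linear_sum scaler_suml.
apply: eq_bigr => i _; rewrite mxE scalerA linearZ; congr (_ *: _).
by rewrite mulrC.
Qed.

Lemma tens_functional_map l A A' (phi : {lrmorphism A -> A'}) (x : tens E A) :
  tens_functional l (tens_map phi x) = phi (tens_functional l x).
Proof.
by rewrite rmorph_sum; apply: eq_bigr => i _; rewrite mxE /= linearZ.
Qed.

Lemma tens_functional_inr A (a : A) : tens_functional l0 (tens_inr E a) = a.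
Proof. by rewrite tens_functional_pure l01 scale1r. Qed.

Lemma tens_split A (x : tens E A) :
  x = tpure 1 (tens_functional l0 x) + tpure alpha (tens_functional l1 x).
Proof.
rewrite {1}[x]tpure_sum !tpure_sumr -big_split; apply: eq_bigr => i _ /=.
by rewrite {1}[_`_i]le tpureDl !tpureZ.
Qed.

(** Conjugation negates the component along [alpha], so a fixed element has twice that component
    zero, and 2 alpha is invertible in E. *)
Lemma tens_conj_fixed A (x : tens E A) :
  tens_conj x = x -> x = tens_inr E (tens_functional l0 x).
Proof.
move=> xx; rewrite {1}[x]tens_split -[RHS]addr0; congr (_ + _).
set a := tens_functional l1 x.
have : tpure alpha a + tpure alpha a = 0.
  have h : tens_conj x = tpure 1 (tens_functional l0 x) + tpure (- alpha) a.
    by rewrite {1}[x]tens_split rmorphD /= !tens_conj_pure rmorph1 conj_alpha.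
  move: h; rewrite xx {1}[x]tens_split => /addrI h.
  by rewrite -/a in h; rewrite {1}h -tpureDl addNr tpure0l.
rewrite -tpureDl => h; suff -> : a = 0 by rewrite tpure0r.
have a2 : alpha + alpha != 0.
  by rewrite -mulr2n -scaler_nat scaler_eq0 negb_or alpha0 andbT.
have : tpure (1 : E) a = 0.
  by rewrite -(mulVf a2) -[a]mul1r -tens_mulE h mulr0.
by move/(congr1 (@tens_functional l0 A)); rewrite tens_functional_inr -(tpure0r A (1 : E)) tens_functional_inr.
Qed.

End TensorFacts.

(** * Descent of the half-spin module *)

Lemma imaginary_quadratic_two_neq0 (F : fieldType) (E : fieldExtType F) :
  imaginary_quadratic_ext E -> 2 != 0 :> F.
Proof.
case=> _ [[[K [f _]] _ _]|[R [f _]]]; last first.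
  by rewrite -(fmorph_eq0 f) rmorph_nat Num.Theory.pnatr_eq0.
rewrite -(rmorph_nat f) fmorph_eq0.
by rewrite -(scaler_nat 2 (1 : K)) scaler_eq0 oner_eq0 orbF.
Qed.

Section HalfSpinDescent.
Variables (F : fieldType) (E : fieldExtType F) (conj : {lrmorphism E -> E}).
Variables (alpha : E) (l0 l1 : {linear E -> F^o}).
Hypotheses (alpha0 : alpha != 0) (conj_alpha : conj alpha = - alpha).
Hypotheses (l01 : l0 1 = 1) (le : forall e, e = l0 e *: 1 + l1 e *: alpha).
Hypothesis two0 : 2 != 0 :> F.
Variables (delta : F) (n k m : nat) (i0 : 'I_n).
Hypotheses (delta0 : delta != 0) (nE : n = (2 * m)%N) (kn : (k <= n)%N).
Hypothesis mk : m = k %[mod 2].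

Local Notation d := (delta%:A : E).
Implicit Types (A : comAlgType F).

Local Notation G := (G_spin conj (n := n) delta k).
Local Notation bas I := (real_basis conj k d alpha i0 I).

Let d0 : d != 0. Proof. by rewrite scaler_eq0 oner_eq0 orbF. Qed.
Let twoE : 2 != 0 :> E.
Proof. by rewrite -scaler_nat scaler_eq0 oner_eq0 orbF. Qed.
Let conj_d : conj d = d. Proof. by rewrite linearZ rmorph1. Qed.

Definition tens_conj_ratio (A : comAlgType F) (x : WClifford E n A) : tens E A :=
  conj_ratio k d (tens_conj conj (A := A)) (tens_inl A) x.

(** The functional [l0] reads the scalar z as an element of [A]; on the preimage of G this loses
    nothing, by [tens_conj_ratio_inr]. *)
Definition ratio_idempotent (A : comAlgType F) (x : WClifford E n A) : A :=
  2^-1 *: (1 + tens_functional l0 (tens_conj_ratio x)).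

Lemma tens_conj_ratio_inr A (x : WClifford E n A) : G_preimage conj delta k x ->
  tens_conj_ratio x = tens_inr E (tens_functional l0 (tens_conj_ratio x)).
Proof.
move=> hx; apply: (tens_conj_fixed alpha0 conj_alpha l01 le two0).
by apply: (bar_conj_ratio d0 twoE conj_d (@tens_conjK _ _ _ _ _ _ conj_alpha le A) (tens_conj_inl conj A) nE kn mk).
Qed.

Lemma tens_conj_ratio_sqr A (x : WClifford E n A) : G_preimage conj delta k x ->
  tens_functional l0 (tens_conj_ratio x) * tens_functional l0 (tens_conj_ratio x) = 1.
Proof.
move=> hx; rewrite -[LHS](tens_functional_inr l01) rmorphM /= -tens_conj_ratio_inr //.
rewrite [_ * _](conj_ratio_sqr d0 twoE conj_d (tens_conj_inl conj A) nE kn mk hx).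
by rewrite -[1]/(tens_inr E 1) tens_functional_inr.
Qed.

Lemma tens_conj_ratio_map A (A' : comAlgType F) (phi : {lrmorphism A -> A'}) (x : WClifford E n A) :
  tens_map phi (tens_conj_ratio x) = tens_conj_ratio (WClifford_map phi x).
Proof.
apply: conj_ratio_exta_map => [e|a|I]; [exact: tens_map_inl|exact: tens_map_conj|].
by rewrite ffunE.
Qed.

Lemma ratio_idempotent_function :
  idempotent_function (WClifford_map (E := E) (n := n)) (G_preimage conj delta k)
    ratio_idempotent.
Proof.
split=> [A x hx|A A' phi x hx].
  rewrite /ratio_idempotent; have := tens_conj_ratio_sqr hx.
  move: (tens_functional _ _) => u uu.
  rewrite -scalerAl -scalerAr mulrDl mul1r mulrDr mulr1 uu.
  rewrite [u + 1]addrC -mulr2n -scaler_nat !scalerA.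
  by rewrite -mulrA mulVf // mulr1.
rewrite /ratio_idempotent linearZ rmorphD rmorph1 /=; congr (_ *: (_ + _)).
by rewrite -tens_functional_map tens_conj_ratio_map.
Qed.

Lemma G_spin_ratio A (x : WClifford E n A) : G x -> tens_conj_ratio x = 1.
Proof.
case=> hx /(_ _ ratio_idempotent_function); rewrite /ratio_idempotent.
have -> : tens_conj_ratio (1 : WClifford E n A) = 1.
  exact: (conj_ratio1 n k d0 twoE _ _).
move=> /(congr1 (fun a => (2 : F) *: a)); rewrite !scalerA divff // !scale1r.
by move=> /addrI h; rewrite tens_conj_ratio_inr // h -[1]/(tens_inr E 1) tens_functional_inr.
Qed.

Lemma G_spin_conj A (x : WClifford E n A) s : G x ->
  spinor_conj k d (tens_conj conj (A := A)) (tens_inl A) (spinor_act x s) =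
  spinor_act x (spinor_conj k d (tens_conj conj (A := A)) (tens_inl A) s).
Proof.
move=> hG; have hx := hG.1.
exact: (spinor_conj_act d0 twoE conj_d (tens_conj_inl conj A) hx _ (G_spin_ratio hG)).
Qed.

Definition even_sets : {set {set 'I_n}} := [set I : {set 'I_n} | ~~ odd #|I|].

Lemma even_setsP (j : 'I_#|even_sets|) : ~~ odd #|enum_val j|.
Proof. by have := enum_valP j; rewrite inE. Qed.

(** Applying [l0] forces the entries into [A]; for points of [G] the coordinates already come from
    [A]. *)
Definition half_spin_matrix (A : comAlgType F) (x : WClifford E n A) :
    'M[A]_#|even_sets| :=
  \matrix_(i, j) tens_functional l0 (real_coord conj k d alpha i0 (tens_inl A)
    (enum_val i) (spinor_act x (exta_map (tens_inl A) (bas (enum_val j))))).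

Lemma sum_even_sets (V : nmodType) (g : {set 'I_n} -> V) :
  \sum_(I : {set 'I_n} | ~~ odd #|I|) g I = \sum_(j < #|even_sets|) g (enum_val j).
Proof. by rewrite -big_enum_val; apply: eq_bigl => I; rewrite inE. Qed.

(** On [G], [x] commutes with J, so it sends fixed basis vectors to fixed spinors, whose coordinates
    are conjugation-invariant and thus lie in [A]. *)
Lemma spinor_act_real_basis A (x : WClifford E n A) : G x -> forall j,
  spinor_act x (exta_map (tens_inl A) (bas (enum_val j))) =
  \sum_i tens_inr E (half_spin_matrix x i j) *: exta_map (tens_inl A) (bas (enum_val i)).
Proof.
move=> hG j; have ej := even_setsP j; have hx := hG.1.
have xe : cl_even x by case: hx => [[]].
have hj : half_spin (exta_map (tens_inl A) (bas (enum_val j))).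
  by move=> I oI; rewrite exta_mapE (half_spin_real_basis _ _ _ _ _ nE) // rmorph0.
rewrite [LHS](real_coord_expand d0 twoE i0 alpha0 conj_alpha nE kn mk (tens_inl A)); last first.
  exact: half_spin_act.
rewrite sum_even_sets; apply: eq_bigr => i _; congr (_ *: _).
rewrite mxE; apply: (tens_conj_fixed alpha0 conj_alpha l01 le two0).
have ei := even_setsP i.
rewrite (bar_real_coord d0 twoE conj_d i0 conj_alpha nE kn mk (tens_conj_inl conj A)) //.
congr (real_coord _ _ _ _ _ _ _ _); rewrite (G_spin_conj _ hG).
congr (spinor_act _ _).
exact: (spinor_conj_real_basis d0 twoE conj_d i0 conj_alpha nE kn mk (tens_conj_inl conj A)).
Qed.

Lemma real_coord_comb (B : comNzRingType) (inj : {rmorphism E -> B})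
    (a : 'I_#|even_sets| -> B) i :
  real_coord conj k d alpha i0 inj (enum_val i)
    (\sum_j a j *: exta_map inj (bas (enum_val j))) = a i.
Proof.
rewrite real_coord_sum (bigD1 i) //= big1 => [|j ji]; rewrite real_coordZ
  (real_coord_basis d0 twoE i0 alpha0 conj_alpha nE kn mk inj _ (even_setsP i)).
  by rewrite eqxx mulr1 addr0.
by rewrite (inj_eq enum_val_inj) eq_sym (negbTE ji) mulr0.
Qed.

Lemma half_spin_matrix_representation :
  representation (WClifford_map (E := E) (n := n)) G half_spin_matrix.
Proof.
split=> [A|A x y hx hy|A A' phi x hx].
- apply/matrixP => i j; rewrite !mxE spinor_act1.
  rewrite (real_coord_basis d0 twoE i0 alpha0 conj_alpha nE kn mk _ _ (even_setsP i)).
  rewrite (inj_eq enum_val_inj) -[_%:R](rmorph_nat (@tens_inr F E A)).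
  exact: tens_functional_inr.
- apply/matrixP => i j; rewrite mxE spinor_actM spinor_act_real_basis // linear_sum.
  under eq_bigr => u _ do rewrite linearZ /= spinor_act_real_basis // scaler_sumr.
  rewrite exchange_big /=.
  (* Collecting the coefficient of each basis vector exposes the entries of the matrix product. *)
  under eq_bigr => u _ do (under eq_bigr => v _ do rewrite scalerA -rmorphM; rewrite -scaler_suml -rmorph_sum).
  rewrite real_coord_comb tens_functional_inr // mxE.
  by apply: eq_bigr => u _; rewrite mulrC.
- apply/matrixP => i j; rewrite !mxE -tens_functional_map.
  rewrite (real_coord_exta_map _ _ _ _ _ _ _ (tens_map_inl phi)).
  rewrite (exta_map_spinor_act (x' := WClifford_map phi x)) => [|I]; last by rewrite ffunE.
  congr (tens_functional l0 (real_coord _ _ _ _ _ _ _ (spinor_act _ _))).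
  by apply/ffunP => I; rewrite !exta_mapE; exact/esym/tens_map_inl.
Qed.

Lemma half_spin_descent : half_spin_defined_over_base conj n delta k.
Proof.
exists #|even_sets|, half_spin_matrix, (fun j => bas (enum_val j)); split.
- exact: half_spin_matrix_representation.
- by move=> j; apply: (half_spin_real_basis _ _ _ _ _ nE); apply: even_setsP.
(* The coordinate lemmas over [E] itself, with the identity as [inj], give existence and
   uniqueness. *)
- move=> t ht; have idE s : exta_map idfun s = s :> exta E n.
    by apply/ffunP => I; rewrite exta_mapE.
  exists (\col_j real_coord conj k d alpha i0 idfun (enum_val j) t); split.
    rewrite {1}(real_coord_expand d0 twoE i0 alpha0 conj_alpha nE kn mk idfun ht).
    by rewrite sum_even_sets; apply: eq_bigr => j _; rewrite mxE idE.
  move=> c tc; apply/colP => i; rewrite mxE tc.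
  under eq_bigr => j _ do rewrite -[bas _]idE.
  by rewrite real_coord_comb.
- exact: spinor_act_real_basis.
Qed.

End HalfSpinDescent.

Theorem corollary3p5 (E0 : fieldType) (E : fieldExtType E0)
    (hE : imaginary_quadratic_ext E)
    (conj : {lrmorphism E -> E}) (hconj : exists a : E, conj a <> a) :
  (forall (delta : E0) (n k m : nat),
     delta != 0 -> (1 <= k <= n)%N -> n = (2 * m)%N -> m = k %[mod 2] ->
     half_spin_defined_over_base conj n delta k) /\
  (forall delta : E0,
     delta != 0 -> half_spin_defined_over_base conj 6 delta 1).
Proof.
have two0 := imaginary_quadratic_two_neq0 hE.
have [alpha [l0 [l1 [alpha0 conj_alpha l01 le]]]] := quadratic_split hE.1 hconj two0.
have descent (delta : E0) (n k m : nat) : delta != 0 -> (1 <= k <= n)%N ->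
    n = (2 * m)%N -> m = k %[mod 2] -> half_spin_defined_over_base conj n delta k.
  move=> delta0 /andP[k1 kn] nE mk.
  (* The bounds on [k] make [n] positive, so index 0 can serve as [i0]. *)
  exact: (half_spin_descent alpha0 conj_alpha l01 le two0 (Ordinal (leq_trans k1 kn)) delta0 nE kn mk).
by split=> // delta delta0; apply: (descent delta 6 1 3).
Qed.
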